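(* Let $SC(a,a,b)$ be the number of lozenge tilings of the hexagon $H(a,a,b)$ that are invariant under rotation by $180^\circ$ around its center, and let $$PP(a,b,c)=\prod_{i=1}^{a}\prod_{j=1}^{b}\prod_{k=1}^{c}\frac{i+j+k-1}{i+j+k-2}.$$ Then for all positive integers $x,y$, $$SC(2x,2x,2y)=PP(x,x,y)^2,$$ $$SC(2x,2x,2y+1)=PP(x,x,y)\,PP(x,x,y+1),$$ $$SC(2x+1,2x+1,2y)=PP(x,x+1,y)^2.$$
   Context: Work in the regular triangular lattice with unit side. $H(a,b,c)$ is the lattice hexagon with all angles $120^\circ$ and side lengths $a,b,c,a,b,c$ in cyclic order. A lozenge is a unit rhombus that is the union of two unit triangles of the lattice sharing an edge; a lozenge tiling of the hexagon is a covering of it by lozenges contained in it, without gaps or overlaps. (Tilings invariant under rotation by $180^\circ$ correspond to self-complementary plane partitions; $PP(a,b,c)$ is MacMahon's product for the number of plane partitions contained in an $a\times b\times c$ box.) *)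

(* Defs.v *)
From mathcomp Require Import all_boot all_order all_algebra.

Set Implicit Arguments.
Unset Strict Implicit.
Unset Printing Implicit Defensive.

Import GRing.Theory.

(* The pair (i, j) stands for the lattice point i * e1 + j * e2, where e1 and  *)
(* e2 are unit vectors at an angle of 60 degrees.  The hexagon H(a,b,c) is     *)
(* placed with its vertices, in counterclockwise order, at                     *)
(*   (c,0), (a+c,0), (a+c,b), (a,b+c), (0,b+c), (0,c),                         *)
(* its sides having directions e1, e2, e2 - e1, -e1, -e2, e1 - e2 and lengths  *)
(* a, b, c, a, b, c.  It lies in the parallelogram 0 <= i <= a+c,              *)
(* 0 <= j <= b+c, so a finite type of unit triangles suffices.                 *)

Definition in_hexagon (a b c : nat) (p : nat * nat) : bool :=
  [&& p.1 <= a + c, p.2 <= b + c & c <= p.1 + p.2 <= a + b + c].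

(* (i, j, true) and (i, j, false) are the two unit triangles into which the    *)
(* unit rhombus with lower left corner (i, j) is cut by its short diagonal.    *)
Definition triangle (a b c : nat) : finType :=
  ('I_(a + c) * 'I_(b + c) * bool)%type.

Definition vertices (a b c : nat) (t : triangle a b c) : seq (nat * nat) :=
  let: (i, j, up) := t in
  if up then [:: (val i, val j); (i.+1, val j); (val i, j.+1)]
  else [:: (i.+1, val j); (val i, j.+1); (i.+1, j.+1)].

(* By convexity, a triangle lies in the hexagon iff its vertices do. *)
Definition hexagon (a b c : nat) : {set triangle a b c} :=
  [set t | all (in_hexagon a b c) (vertices t)].

Definition share_edge (a b c : nat) (t u : triangle a b c) : bool :=
  count [in vertices u] (vertices t) == 2.

(* A lozenge is represented by the set of its two unit triangles. *)
Definition is_lozenge (a b c : nat) (L : {set triangle a b c}) : bool :=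
  [exists t, exists u, share_edge t u && (L == [set t; u])].

Definition is_tiling (a b c : nat) (T : {set {set triangle a b c}}) : bool :=
  [forall L in T, is_lozenge L] && partition T (hexagon a b c).

Definition rot180_point (a b c : nat) (p : nat * nat) : nat * nat :=
  (a + c - p.1, b + c - p.2).

Definition rot180 (a b c : nat) (t : triangle a b c) : triangle a b c :=
  let: (i, j, up) := t in (rev_ord i, rev_ord j, ~~ up).

Lemma vertices_rot180 (a b c : nat) (t : triangle a b c) :
  perm_eq (vertices (rot180 t)) (map (rot180_point a b c) (vertices t)).
Proof.
case: t => [[i j] up]; have [hi hj] := (ltn_ord i, ltn_ord j).
by case: up; rewrite /= /rot180_point /= !subnSK // -[X in perm_eq X _]revK
  perm_rev perm_refl.
Qed.

Definition rot180_tiling (a b c : nat) (T : {set {set triangle a b c}}) :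
    {set {set triangle a b c}} :=
  [set [set rot180 t | t in L] | L : {set triangle a b c} in T].

Definition SC (a b c : nat) : nat :=
  #|[set T : {set {set triangle a b c}} | is_tiling T & rot180_tiling T == T]|.

Local Open Scope ring_scope.

Definition PP (a b c : nat) : rat :=
  \prod_(1 <= i < a.+1) \prod_(1 <= j < b.+1) \prod_(1 <= k < c.+1)
    ((i%:R + j%:R + k%:R - 1) / (i%:R + j%:R + k%:R - 2)).

(* Main.v *)
(* Cut the hexagon H(n,n,m) along its axis i + j = n + m, of length N = n + m.  A   *)
(* centrally symmetric tiling is determined by its lower half and by the set S of   *)
(* the n lozenges crossing the axis, which is symmetric under i -> N - 1 - i.  The  *)
(* lower half is then a trapezoid with dents S; peeling its strips one triangle at  *)
(* a time shows that it has det 'C(s_j, i) tilings, a Vandermonde product divided   *)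
(* by 0! 1! ... (n-1)!.  Writing the elements of S as centre +- z (and possibly the *)
(* centre itself), the product becomes prod 2z (z^2)^b times the square of the      *)
(* Vandermonde product of the z^2, so by Andreief's identity the sum over S is the  *)
(* determinant of a matrix of moments.  With respect to the bases                   *)
(* prod_(l<i) (X - z_l^2) and prod_(l<j) (X - z_(M+l)^2) of polynomials in z^2 the  *)
(* moments are ratios of factorials, and the determinant is evaluated by column     *)
(* operations.                                                                      *)

Require Import Defs.
From mathcomp Require Import all_boot all_order all_algebra.
From mathcomp Require Import perm fingroup zify ring.

Set Implicit Arguments.
Unset Strict Implicit.
Unset Printing Implicit Defensive.

Import Order.TTheory GRing.Theory Num.Theory.

(** * Tilings of regions *)

(** The tilings of a half hexagon are summed over all symmetric choices of the lozenges on the axis.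
    [SC_tilings] reduces the count to trapezoids with dents, and [tilings_trapezoid] with
    [rowdet_vdm] evaluates each of these as a Vandermonde product over the dent positions. For a
    symmetric dent set this product is, by [vdm_symmetric], a weighted squared Vandermonde product
    in the squared distances to the centre, and [sum_vdm_sqr] turns the sum over sets into a
    determinant of moments ([SC_moment]).

    Andreief's identity allows different polynomial bases for rows and columns. With Newton bases at
    the first nodes of the summation range and at the nodes just beyond it, every moment is a ratio
    of factorials ([momentE]). Apart from row factors, column factors and signs, its entries depend
    on i + j only, and [det_hankel_factr] evaluates the determinant. [PP_fact_block] writes
    MacMahon's product in the same blocks of factorials, so the two sides agree after cancellation.

    The three identities correspond to the three admissible pairs ([b], [e]) of parities of n and N
    = n + m. The pair n odd, N even is excluded by [b ==> e]: a symmetric set of odd size contains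
    the centre, which must then be an integer. *)

Variant near_spec (i k : nat) : bool -> bool -> bool -> Prop :=
  | NearEq of k = i : near_spec i k true false false
  | NearSucc of k = i.+1 : near_spec i k false true false
  | NearPred of k.+1 = i : near_spec i k false false true
  | NearFar of k <> i & k <> i.+1 & k.+1 <> i : near_spec i k false false false.

(** Deciding the three comparisons together makes the vertex count in [share_edge] computable by
    cases. *)
Lemma nearP (i k : nat) : near_spec i k (k == i) (k == i.+1) (k.+1 == i).
Proof.
have [ki|ki] := eqVneq k i; last have [ki1|ki1] := eqVneq k i.+1;
  last have [ki2|ki2] := eqVneq k.+1 i.
- have -> : (k == i.+1) = false by lia.
  have -> : (k.+1 == i) = false by lia.
  exact: NearEq.
- have -> : (k.+1 == i) = false by lia.
  exact: NearSucc.
- exact: NearPred.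
- by apply: NearFar; apply/eqP.
Qed.

Section Tilings.
Variables a b c : nat.
Implicit Types (t u : triangle a b c) (R : {set triangle a b c}).

Definition tiles R (T : {set {set triangle a b c}}) : bool :=
  [forall L in T, is_lozenge L] && partition T R.

Definition tilings R : nat := #|[set T | tiles R T]|.

Lemma share_edgeP t u :
  share_edge t u =
    let: (i, j, s) := t in let: (k, l, s') := u in
    (s' == ~~ s) &&
    (if s then [|| (k == i :> nat) && (l == j :> nat),
                   (k.+1 == i) && (l == j :> nat) |
                   (k == i :> nat) && (l.+1 == j)]
     else [|| (k == i :> nat) && (l == j :> nat),
                   (k == i.+1 :> nat) && (l == j :> nat) |
                   (k == i :> nat) && (l == j.+1 :> nat)]).
Proof.
case: t => [[i j] []]; case: u => [[k l] []];
rewrite /share_edge /= !inE !xpair_eqE !eqSS !(eq_sym (val i)) !(eq_sym (val j))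
  !(eq_sym i.+1) !(eq_sym j.+1);
by case: nearP; case: nearP.
Qed.

Lemma share_edge_orient t u : share_edge t u -> u.2 = ~~ t.2.
Proof. by rewrite share_edgeP; case: t => [[i j] s]; case: u => [[k l] s'] /andP[/eqP]. Qed.

Lemma share_edge_neq t u : share_edge t u -> t != u.
Proof. by move/share_edge_orient => e; apply/eqP => tu; move: e; rewrite tu; case: (u.2). Qed.

Lemma share_edgeC t u : share_edge t u = share_edge u t.
Proof.
rewrite !share_edgeP; case: t => [[i j] []]; case: u => [[k l] []] //=; lia.
Qed.

Lemma lozengeP (L : {set triangle a b c}) t :
  is_lozenge L -> t \in L -> exists2 u, share_edge t u & L = [set t; u].
Proof.
move=> /existsP[v /existsP[w /andP[vw /eqP->]]] /[!inE] /orP[]/eqP->.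
  by exists w.
by exists v; rewrite ?[share_edge w v]share_edgeC // setUC.
Qed.

Lemma lozenge2 t u : share_edge t u -> is_lozenge [set t; u].
Proof. by move=> tu; apply/existsP; exists t; apply/existsP; exists u; rewrite tu /=. Qed.

Lemma tiles_lozenge R T L : tiles R T -> L \in T -> is_lozenge L.
Proof. by case/andP=> /forall_inP h _ /h. Qed.

Lemma tiles_partition R T : tiles R T -> partition T R.
Proof. by case/andP. Qed.

Lemma tilings0 : tilings set0 = 1.
Proof.
rewrite /tilings (_ : [set T | _] = [set set0]) ?cards1 //.
apply/setP=> T; rewrite !inE /tiles partition_set0.
have [->|] := eqVneq T set0; last by rewrite andbF.
by rewrite andbT; apply/forall_inP => L; rewrite inE.
Qed.

Lemma tilings_with R t u : t \in R -> u \in R -> share_edge t u ->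
  #|[set T | tiles R T & [set t; u] \in T]| = tilings (R :\: [set t; u]).
Proof.
move=> tR uR tu; set L := [set t; u].
have LR : L \subset R by apply/subsetP=> v /[!inE] /orP[]/eqP->.
have L0 : L != set0 by apply/set0Pn; exists t; rewrite !inE eqxx.
have Ldis (T : {set {set triangle a b c}}) : partition T (R :\: L) -> L \notin T.
  move=> /partitionS pT; apply/negP => /pT /subsetP/(_ t).
  by rewrite !inE eqxx /= => /(_ isT).
have inj : {in [set T | tiles (R :\: L) T] &, injective (fun T => L |: T)}.
  move=> T T' /[!inE] /andP[_ pT] /andP[_ pT'] eT.
  by rewrite -(setU1K (Ldis _ pT)) eT (setU1K (Ldis _ pT')).
rewrite /tilings -(card_in_imset inj); apply: eq_card => T.
apply/idP/imsetP => [/[!inE] /andP[/andP[/forall_inP lT pT] LT] | [T' /[!inE]]].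
  exists (T :\ L); last by rewrite setD1K.
  rewrite inE /tiles partitionD1 // andbT.
  by apply/forall_inP => L' /setD1P[_ /lT].
case/andP=> /forall_inP lT pT ->; rewrite setU11 andbT.
apply/andP; split.
  by apply/forall_inP => L' /setU1P[->|/lT//]; exact: lozenge2.
rewrite -[X in partition _ X](setID R L) (setIidPr LR).
by apply: partitionU1 => //; rewrite -setI_eq0; apply/eqP/setP=> v;
  rewrite !inE; case: (_ || _).
Qed.

(** Exactly one lozenge of a tiling covers [t], so tilings are classified by the partner of [t]. All
    peeling steps below are instances of this. *)
Lemma tilings_expand R t : t \in R ->
  tilings R = \sum_(u in R | share_edge t u) tilings (R :\: [set t; u]).
Proof.
move=> tR; rewrite /tilings -sum1_card.
have pbT T : tiles R T -> exists u, [&& u \in R, share_edge t u & [set t; u] \in T].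
  move=> tT; have := tiles_partition tT => pT.
  have : t \in cover T by rewrite (cover_partition pT).
  case/bigcupP=> L LT tL; have [u tu eL] := lozengeP (tiles_lozenge tT LT) tL.
  exists u; rewrite tu -eL LT !andbT.
  by apply: (subsetP (partitionS pT LT)); rewrite eL !inE eqxx orbT.
(* The default [t] is never reached on a tiling, by [pbT]. *)
pose f (T : {set {set triangle a b c}}) := 
  odflt t [pick u | [&& u \in R, share_edge t u & [set t; u] \in T]].
have fP T : tiles R T -> [&& f T \in R, share_edge t (f T) & [set t; f T] \in T].
  move=> /pbT [u hu]; rewrite /f; case: pickP => [//|/(_ u)]; by rewrite hu.
rewrite (partition_big f (fun u => (u \in R) && share_edge t u)) /=; last first.
  by move=> T /[!inE] /fP/and3P[-> ->].
apply: eq_bigr => u /andP[uR tu]; rewrite sum1_card -/(tilings _) -tilings_with //.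
apply: eq_card => T; rewrite [LHS]unfold_in !inE; case tT: (tiles R T) => //=.
have /and3P[fR tf fT] := fP _ tT.
apply/eqP/idP => [<- //|uT].
have pT := tiles_partition tT.
have tv (v : triangle a b c) : t \in [set t; v] by rewrite !inE eqxx.
have := def_pblock (partition_trivIset pT) uT (tv _).
rewrite (def_pblock (partition_trivIset pT) fT (tv _)) => /setP/(_ u).
rewrite !inE eqxx orbT => /orP[/eqP ut|/eqP->//].
by move: (share_edge_neq tu); rewrite ut eqxx.
Qed.

Lemma tilings_none R t : t \in R -> {in R, forall u, ~~ share_edge t u} ->
  tilings R = 0.
Proof.
move=> tR nR; rewrite (tilings_expand tR) big_pred0 // => u.
by case: (boolP (u \in R)) => //= /nR/negPf.
Qed.

Lemma tilings_forced R t u : t \in R -> u \in R -> share_edge t u ->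
  {in R, forall v, share_edge t v -> v = u} ->
  tilings R = tilings (R :\: [set t; u]).
Proof.
move=> tR uR tu unq; rewrite (tilings_expand tR) (big_pred1 u) // => v.
apply/andP/eqP => [[vR tv]|->//]; exact: unq.
Qed.

Lemma tilings_choice R t u v : t \in R -> u \in R -> v \in R ->
  share_edge t u -> share_edge t v -> u != v ->
  {in R, forall w, share_edge t w -> w = u \/ w = v} ->
  tilings R = tilings (R :\: [set t; u]) + tilings (R :\: [set t; v]).
Proof.
move=> tR uR vR tu tv uv unq; rewrite (tilings_expand tR).
rewrite (bigD1 u) ?uR //= (big_pred1 v) // => w.
apply/andP/eqP => [[/andP[wR tw] wu]|->].
  by case: (unq _ wR tw) wu => ->; rewrite ?eqxx.
by rewrite vR tv eq_sym.
Qed.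

End Tilings.

(** * Peeling a trapezoid *)

Section Strips.
Variables n m : nat.
Notation N := (n + m).
Implicit Types (s k d i : nat) (U V : seq nat).

(* Strip number i + j contains the up-triangle (i, j), strip i + j + 1 the down-   *)
(* triangle (i, j).  The region consists of the strips m, ..., s - 1, without the   *)
(* up-triangles of abscissa in V of the last one, and of the part of strip s which  *)
(* remains when its triangles are removed from left to right: the up-triangles of   *)
(* abscissa >= k not in U and the down-triangles of abscissa >= d.                  *)
Definition region s V k d U : {set triangle n n m} :=
  [set t : triangle n n m | let: (i, j, up) := t in
   if up then (m <= i + j) &&
     ((i + j < s) && ~~ (((i + j).+1 == s) && ((i : nat) \in V))
      || [&& i + j == s, k <= i & (i : nat) \notin U])
   else (m <= (i + j).+1) &&
     (((i + j).+1 < s) || ((i + j).+1 == s) && (d <= i))].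

Lemma region_up s V k d U (i j : 'I_N) :
  ((i, j, true) \in region s V k d U) = (m <= i + j) &&
     ((i + j < s) && ~~ (((i + j).+1 == s) && ((i : nat) \in V))
      || [&& i + j == s, k <= i & (i : nat) \notin U]).
Proof. by rewrite inE. Qed.

Lemma region_down s V k d U (i j : 'I_N) :
  ((i, j, false) \in region s V k d U) = (m <= (i + j).+1) &&
     (((i + j).+1 < s) || ((i + j).+1 == s) && (d <= i)).
Proof. by rewrite inE. Qed.

(** At a dent the up-triangle is already missing, so the down-triangle that follows it becomes
    pending. *)
Lemma region_removed s V i U :
  region s V i i (i :: U) = region s V i.+1 i U.
Proof.
apply/setP => [[[k l] []]]; rewrite ?region_up ?region_down // inE.
by have [ki|ki] := eqVneq (k : nat) i; case: ((k : nat) \in V); case: ((k : nat) \in U); lia.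
Qed.

(** The last up-triangle of the strip has lost its left neighbour, and no down-triangle lies to its
    right. *)
Lemma tilings_region_top s V i U : m <= s -> s < N -> i = s -> i \notin U ->
  tilings (region s V i i U) = 0.
Proof.
move=> ms sN -> iU.
have hj : 0 < N by lia.
apply: (@tilings_none _ _ _ _ (Ordinal sN, Ordinal hj, true)) => [|[[k l] []]].
- by rewrite region_up /= iU; lia.
- by rewrite share_edgeP.
- by rewrite region_down share_edgeP /=; lia.
Qed.

Lemma tilings_region_skip s V i U : m <= s -> s < N -> i < s -> i \notin U ->
  tilings (region s V i i U) = tilings (region s V i.+1 i.+1 U).
Proof.
move=> ms sN si iU.
have hi : i < N by lia.
have hj : s - i < N by lia.
have hj' : s - i.+1 < N by lia.
rewrite (@tilings_forced _ _ _ _ (Ordinal hi, Ordinal hj, true)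
  (Ordinal hi, Ordinal hj', false)).
- congr tilings; apply/setP => [[[k l] []]];
  rewrite ![in LHS]inE ?region_up ?region_down !xpair_eqE -!val_eqE /=.
    by case: ((k : nat) \in U); lia.
  lia.
- by rewrite region_up /= iU; lia.
- by rewrite region_down /=; lia.
- by rewrite share_edgeP /=; lia.
- move=> [[k l] []]; first by rewrite share_edgeP.
  rewrite region_down share_edgeP /= => h1 h2.
  by congr (_, _, _); apply: val_inj => /=; lia.
Qed.

Lemma tilings_region_below s V i U : m < s -> s < N -> i < s ->
  i \notin V -> i.+1 \in U ->
  tilings (region s V i.+1 i U) = tilings (region s (rcons V i) i.+1 i.+1 U).
Proof.
move=> ms sN si iV iU.
have hi : i < N by lia.
have hj : s - i.+1 < N by lia.
rewrite (@tilings_forced _ _ _ _ (Ordinal hi, Ordinal hj, false)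
  (Ordinal hi, Ordinal hj, true)).
- congr tilings; apply/setP => [[[k l] []]];
  rewrite ![in LHS]inE ?region_up ?region_down !xpair_eqE -!val_eqE /= ?mem_rcons ?inE.
    by case: ((k : nat) \in V); case: ((k : nat) \in U); lia.
  lia.
- by rewrite region_down /=; lia.
- by rewrite region_up /= (negPf iV); lia.
- by rewrite share_edgeP /=; lia.
- move=> [[k l] []]; last by rewrite share_edgeP.
  rewrite region_up share_edgeP /= => h1 h2.
  have ki : (k : nat) <> i.+1 by move=> e; rewrite e iU in h1; lia.
  by congr (_, _, _); apply: val_inj => /=; lia.
Qed.

(** In the lowest strip a pending down-triangle followed by a dent has no partner left. *)
Lemma tilings_region_stuck s V i U : m = s -> s < N -> i < s ->
  i.+1 \in U -> tilings (region s V i.+1 i U) = 0.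
Proof.
move=> ms sN si iU.
have hi : i < N by lia.
have hj : s - i.+1 < N by lia.
apply: (@tilings_none _ _ _ _ (Ordinal hi, Ordinal hj, false)) => [|[[k l] []]].
- by rewrite region_down /=; lia.
- rewrite region_up share_edgeP /= => h1; apply/negP => h2.
  have ki : (k : nat) <> i.+1 by move=> e; rewrite e iU in h1; lia.
  lia.
- by rewrite share_edgeP.
Qed.

Lemma tilings_region_right s V i U : m = s -> s < N -> i < s -> i.+1 \notin U ->
  tilings (region s V i.+1 i U) = tilings (region s V i.+2 i.+1 U).
Proof.
move=> ms sN si iU.
have hi : i < N by lia.
have hi' : i.+1 < N by lia.
have hj : s - i.+1 < N by lia.
rewrite (@tilings_forced _ _ _ _ (Ordinal hi, Ordinal hj, false)
  (Ordinal hi', Ordinal hj, true)).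
- congr tilings; apply/setP => [[[k l] []]];
  rewrite ![in LHS]inE ?region_up ?region_down !xpair_eqE -!val_eqE /=.
    by case: ((k : nat) \in V); case: ((k : nat) \in U); lia.
  lia.
- by rewrite region_down /=; lia.
- by rewrite region_up /= iU; lia.
- by rewrite share_edgeP /=; lia.
- move=> [[k l] []]; last by rewrite share_edgeP.
  rewrite region_up share_edgeP /= => h1 h2.
  by congr (_, _, _); apply: val_inj => /=; lia.
Qed.

Lemma tilings_region_choice s V i U : m < s -> s < N -> i < s ->
  i \notin V -> i.+1 \notin U ->
  tilings (region s V i.+1 i U) =
  tilings (region s (rcons V i) i.+1 i.+1 U) + tilings (region s V i.+2 i.+1 U).
Proof.
move=> ms sN si iV iU.
have hi : i < N by lia.
have hi' : i.+1 < N by lia.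
have hj : s - i.+1 < N by lia.
rewrite (@tilings_choice _ _ _ _ (Ordinal hi, Ordinal hj, false)
  (Ordinal hi, Ordinal hj, true) (Ordinal hi', Ordinal hj, true)).
- congr (_ + _); congr tilings; apply/setP => [[[k l] []]];
  rewrite ![in LHS]inE ?region_up ?region_down !xpair_eqE -!val_eqE /= ?mem_rcons ?inE.
  + by case: ((k : nat) \in V); case: ((k : nat) \in U); lia.
  + lia.
  + by case: ((k : nat) \in V); case: ((k : nat) \in U); lia.
  + lia.
- by rewrite region_down /=; lia.
- by rewrite region_up /= (negPf iV); lia.
- by rewrite region_up /= iU; lia.
- by rewrite share_edgeP /=; lia.
- by rewrite share_edgeP /=; lia.
- by rewrite !xpair_eqE -val_eqE /=; lia.
- move=> [[k l] []]; last by rewrite share_edgeP.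
  rewrite region_up share_edgeP /= => h1 h2.
  have [ki|ki] := eqVneq (k : nat) i; [left|right];
  by congr (_, _, _); apply: val_inj => /=; lia.
Qed.

Local Open Scope ring_scope.

(* The value 0 for a wrong number of rows is the number of tilings of a trapezoid *)
(* with a wrong number of dents.                                                   *)
Definition rowdet k (rows : seq (nat -> rat)) : rat :=
  if size rows == k
  then \det (\matrix_(j < k, r < k) nth (fun=> 0) rows j r) else 0.

Lemma rowdet_eq k l1 f g l2 : (forall r, f r = g r) ->
  rowdet k (l1 ++ f :: l2) = rowdet k (l1 ++ g :: l2).
Proof.
move=> fg; rewrite /rowdet !size_cat /=; case: eqP => // _; congr (\det _).
apply/matrixP=> j r; rewrite !mxE !nth_cat; case: ifP => // _.
by case: (j - _)%N => //=.
Qed.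

Lemma rowdetD k l1 f g h l2 : (forall r, f r = g r + h r) ->
  rowdet k (l1 ++ f :: l2) = rowdet k (l1 ++ g :: l2) + rowdet k (l1 ++ h :: l2).
Proof.
move=> fgh; rewrite /rowdet !size_cat /=; case: eqP => [sz|]; last by rewrite addr0.
have hj : (size l1 < k)%N by rewrite -sz addnS ltnS leq_addr.
rewrite (@determinant_multilinear _ _ _
   (\matrix_(j, r) nth (fun=> 0) (l1 ++ g :: l2) j r)
   (\matrix_(j, r) nth (fun=> 0) (l1 ++ h :: l2) j r) (Ordinal hj) 1 1) ?mul1r //.
- by apply/rowP=> r; rewrite !mxE /= !nth_cat ltnn subnn /= !mul1r.
- apply/matrixP=> j r; rewrite !mxE !nth_cat; set x := lift _ _.
  have : val x != size l1.
    apply/eqP => /(@val_inj _ _ _ x (Ordinal hj))/eqP.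
    by rewrite eq_sym (negPf (neq_lift _ _)).
  by case: ltngtP => //; rewrite -subn_gt0; case: (_ - _)%N.
- apply/matrixP=> j r; rewrite !mxE !nth_cat; set x := lift _ _.
  have : val x != size l1.
    apply/eqP => /(@val_inj _ _ _ x (Ordinal hj))/eqP.
    by rewrite eq_sym (negPf (neq_lift _ _)).
  by case: ltngtP => //; rewrite -subn_gt0; case: (_ - _)%N.
Qed.

Definition binrow (v r : nat) : rat := ('C(v, r))%:R.
(** For v <= w this is the sum of [binrow x] over v <= x < w: it gathers all positions that a dent
    of the next strip can take between two consecutive dents v and w. *)
Definition bindiff (v w r : nat) : rat := ('C(w, r.+1))%:R - ('C(v, r.+1))%:R.

Lemma bindiff_succ v w r : bindiff v w r = binrow v r + bindiff v.+1 w r.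
Proof. by rewrite /bindiff /binrow binS natrD; ring. Qed.

Lemma sum_ord_leq k j (a : nat -> rat) : (j < k)%N ->
  \sum_(l < k) (l <= j)%:R * a l = \sum_(0 <= l < j.+1) a l.
Proof.
move=> jk; rewrite big_mkord (big_ord_widen k a jk) [RHS]big_mkcond /=.
by apply: eq_bigr => l _; rewrite ltnS; case: ifP; rewrite ?mul1r ?mul0r.
Qed.

(** Subtracting from each row its predecessor clears the first column, since 'C(v, 0) = 1, except in
    the top row; expanding along that column lowers the size by one. *)
Lemma rowdet_bindiff k u0 u :
  rowdet k.+1 (map binrow (u0 :: u)) = rowdet k (pairmap bindiff u0 u).
Proof.
rewrite /rowdet size_map size_pairmap /= eqSS; case: eqP => // sz.
pose L : 'M[rat]_k.+1 := \matrix_(j, l) (l <= j)%:R.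
pose f := nth 0%N (u0 :: u).
pose A : 'M[rat]_k.+1 := \matrix_(j, r)
  if (j : nat) is j'.+1 then binrow (f j) r - binrow (f j') r else binrow u0 r.
have LA : \matrix_(j < k.+1, r < k.+1) nth (fun=> 0) (map binrow (u0 :: u)) j r
  = L *m A.
  apply/matrixP=> j r; rewrite !mxE (nth_map 0%N) /= ?sz //.
  pose a l := if l is l'.+1 then binrow (f l) r - binrow (f l') r else binrow u0 r.
  transitivity (\sum_(l < k.+1) (l <= j)%:R * a l);
    last by apply: eq_bigr => l _; rewrite !mxE.
  rewrite sum_ord_leq // /a.
  rewrite big_nat_recl //= telescope_sumr // -/(f 0%N) /f /=; ring.
rewrite LA det_mulmx (_ : \det L = 1) ?mul1r; last first.
  rewrite det_trig; last by apply/is_trig_mxP => i j ij; rewrite mxE leqNgt ij.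
  by rewrite big1 // => i _; rewrite mxE leqnn.
rewrite (expand_det_col _ 0) big_ord_recl big1 ?addr0 => [|i _]; last first.
  by rewrite !mxE /= /binrow !bin0 subrr mul0r.
rewrite !mxE /= /binrow bin0 mul1r /cofactor /= expr0 mul1r; congr (\det _).
apply/matrixP=> j r; rewrite !mxE /= (nth_pairmap 0%N) ?sz //.
Qed.

(* Position i carries a pending down-triangle in the first region and none in the   *)
(* second.  A pending down-triangle is matched either below, which adds the row     *)
(* [binrow i], or with the next up-triangle, after which i + 1 is pending; this is  *)
(* the multilinear expansion bindiff i u = binrow i + bindiff i.+1 u.               *)
Lemma tilings_strip s i :
  (m <= s)%N -> (s < N)%N -> (i <= s)%N ->
  (forall V, sorted ltn V -> {in V, forall v, v < s}%N -> (m = s -> V = [::]) ->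
     (tilings (region s V s.+1 s [::]))%:R = rowdet (s - m) (map binrow V)) ->
  forall V, sorted ltn V -> {in V, forall v, v < i}%N -> (m = s -> V = [::]) ->
  (forall u, path ltn i u -> {in u, forall v, v <= s}%N ->
    (tilings (region s V i.+1 i u))%:R
       = rowdet (s - m) (map binrow V ++ pairmap bindiff i u)) /\
  (forall u, sorted ltn u -> {in u, forall v, i <= v <= s}%N ->
    (tilings (region s V i i u))%:R
       = if u is u0 :: u' then
           rowdet (s - m) (map binrow V ++ pairmap bindiff u0 u') else 0).
Proof.
(* Induction on the number of positions still to be swept. *)
move=> ms sN; move: {2}(s - i)%N (erefl (s - i)%N) => d.
elim: d i => [|d IH] i di si HQ V sV Vi V0.
  have eis : i = s by lia.
  have A1 u : path ltn i u -> {in u, forall v, v <= s}%N -> (tilings (region s V i.+1 i u))%:R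
       = rowdet (s - m) (map binrow V ++ pairmap bindiff i u).
    case: u => [|u0 u] /=; last first.
      by case/andP=> iu0 _ /(_ u0); rewrite inE eqxx => /(_ isT); lia.
    by move=> _ _; rewrite cats0 eis HQ // -eis.
  split => // -[|u0 u] /= su us; first by rewrite tilings_region_top.
  have /andP[h1 h2] := us u0 (mem_head _ _).
  have eu0 : u0 = i by lia.
  rewrite {1}eu0 region_removed A1 -?eu0 // => v vu.
  by have := us v; rewrite inE vu orbT => /(_ isT)/andP[].
have isn : (i < s)%N by lia.
have iV : i \notin V by apply/negP => /Vi; rewrite ltnn.
have dS : (s - i.+1 = d)%N by lia.
have ViS : {in V, forall v, v < i.+1}%N by move=> v /Vi /leqW.
have sVr : sorted ltn (rcons V i).
  case: V sV Vi {V0 iV ViS} => //= v V sV Vi.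
  by rewrite rcons_path sV /=; apply: Vi; rewrite mem_last.
have Vri : {in rcons V i, forall v, v < i.+1}%N.
  by move=> v; rewrite mem_rcons inE => /orP[/eqP->|/ViS].
have [A1' A0'] := IH i.+1 dS isn HQ V sV ViS V0.
have rowdet0 l f l' : m = s -> rowdet (s - m) (l ++ f :: l') = 0.
  by move=> ->; rewrite /rowdet subnn size_cat addnS.
have A1 u : path ltn i u -> {in u, forall v, v <= s}%N -> (tilings (region s V i.+1 i u))%:R
       = rowdet (s - m) (map binrow V ++ pairmap bindiff i u).
  (* In the lowest strip nothing can be matched below; if dents remain, both sides are 0, because a
     determinant of size 0 admits no row. *)
  move=> pu us; have [ems|nms] := eqVneq m s.
    have [iu|iu] := boolP (i.+1 \in u).
      rewrite tilings_region_stuck //.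
      by case: u iu {pu us} => // u0 u _; rewrite /= rowdet0.
    rewrite tilings_region_right // A1' //; last first.
      case: u iu pu {us} => //= u0 u /[!inE] h /andP[h1 ->].
      by rewrite ltn_neqAle h1; move: h; case: eqP.
    by case: u {iu pu us} => //= u0 u; rewrite !rowdet0.
  have {}nms : (m < s)%N by lia.
  have [_ B0] := IH i.+1 dS isn HQ (rcons V i) sVr Vri ltac:(lia).
  case: u pu us => [|u0 u] /= => [_ _|/andP[iu0 pu] us].
    by rewrite tilings_region_choice // natrD A1' // B0 //= add0r.
  have u0s : (u0 <= s)%N by apply: us; rewrite mem_head.
  have us' : {in u, forall v, v <= s}%N by move=> v vu; apply: us; rewrite inE vu orbT.
  have uge : {in u0 :: u, forall v, i < v <= s}%N.
    move=> v vu; rewrite us // andbT; move: vu; rewrite inE => /orP[/eqP->//|vu].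
    by apply: ltn_trans iu0 _; have /allP := order_path_min ltn_trans pu; exact.
  (* A dent right after [i] leaves only the match below; accordingly [bindiff i.+1 i.+1]
     vanishes. *)
  have [eu0|nu0] := eqVneq i.+1 u0.
    move: pu us uge; rewrite -eu0 => pu us uge.
    rewrite tilings_region_below ?mem_head // B0 //.
    rewrite map_rcons cat_rcons; apply: rowdet_eq => r.
    by rewrite bindiff_succ /bindiff subrr addr0.
  have iu : i.+1 \notin u0 :: u.
    rewrite inE (negPf nu0) /=; apply/negP => /(allP (order_path_min ltn_trans pu)) /=; lia.
  rewrite tilings_region_choice // natrD A1' //=; last by rewrite ltn_neqAle nu0 iu0.
  rewrite B0 // map_rcons cat_rcons.
  by rewrite -(rowdetD _ _ _ (bindiff_succ i u0)).
split => // -[|u0 u] /= su us; first by rewrite tilings_region_skip // A0'.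
have /andP[h1 h2] := us u0 (mem_head _ _).
have us' : {in u, forall v, v <= s}%N.
  by move=> v vu; have := us v; rewrite inE vu orbT => /(_ isT)/andP[].
have [eu0|nu0] := eqVneq i u0.
  by rewrite -eu0 region_removed A1 ?eu0.
have ugt : {in u0 :: u, forall v, i < v <= s}%N.
  move=> v; rewrite inE => /orP[/eqP->|vu]; first by rewrite h2 ltn_neqAle nu0 h1.
  rewrite us' // andbT; apply: leq_ltn_trans h1 _.
  by have /allP := order_path_min ltn_trans su; exact.
rewrite tilings_region_skip // ?A0' //.
by apply/negP => /ugt; rewrite ltnn.
Qed.

(** Removing one strip replaces the dents by an interlacing set with one element fewer, and
    [rowdet_bindiff] shows that the determinant obeys the same recursion. *)
Lemma tilings_trapezoid s u : (m < s)%N -> (s <= N)%N -> sorted ltn u ->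
  {in u, forall v, v < s}%N ->
  (tilings (region s u s.+1 s [::]))%:R = rowdet (s - m) (map binrow u).
Proof.
elim: s u => // s IH u ms sN su us.
(* The dents left in the last full strip become the dents [U] of the strip about to be swept. *)
have top V : (m <= s)%N -> region s.+1 V s.+2 s.+1 [::] = region s [::] 0 0 V.
  move=> ms'; apply/setP => [[[k l] []]]; rewrite ?region_up ?region_down ?in_nil /=.
    by case: ((k : nat) \in V); lia.
  lia.
have HQ V : sorted ltn V -> {in V, forall v, v < s}%N -> (m = s -> V = [::]) ->
     (tilings (region s V s.+1 s [::]))%:R = rowdet (s - m) (map binrow V).
  move=> sV Vs V0; have [ems|nms] := eqVneq m s; last by apply: IH => //; lia.
  have -> : (s - m = 0)%N by lia.
  rewrite V0 // /rowdet /= det_mx00.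
  rewrite (_ : region _ _ _ _ _ = set0) ?tilings0 //.
  by apply/setP => [[[k l] []]]; rewrite ?region_up ?region_down !inE /=; lia.
rewrite top //; have [_ ->] // := @tilings_strip s 0 ms sN (leq0n _) HQ [::] isT
  ltac:(done) ltac:(done).
rewrite subSn //; case: u su us => [|u0 u] su us; last by rewrite rowdet_bindiff.
by rewrite /rowdet.
Qed.
Local Close Scope ring_scope.

End Strips.

(** * Centrally symmetric tilings *)

Definition symmetric_set N (S : {set 'I_N}) := [forall i, (rev_ord i \in S) == (i \in S)].

Section CentralSymmetry.
Variables n m : nat.
Notation N := (n + m).

Notation rot := (@rot180 n n m).

Lemma rotK : involutive rot.
Proof. by case=> [[i j] up]; rewrite /rot180 !rev_ordK negbK. Qed.

Lemma rot_inj : injective rot. Proof. exact: can_inj rotK. Qed.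

Lemma mem_rot (A : {set triangle n n m}) t : (t \in rot @: A) = (rot t \in A).
Proof. by rewrite -{1}[t]rotK mem_imset //; exact: rot_inj. Qed.

Lemma rot_setK (A : {set triangle n n m}) : rot @: (rot @: A) = A.
Proof. by apply/setP => t; rewrite !mem_rot rotK. Qed.

Lemma rot_lozenge (L : {set triangle n n m}) : is_lozenge L -> is_lozenge (rot @: L).
Proof.
case/existsP=> t /existsP[u /andP[tu /eqP->]].
rewrite imsetU !imset_set1; apply: lozenge2; move: tu; rewrite !share_edgeP.
case: t => [[i j] []]; case: u => [[k l] []] //=;
  move: (ltn_ord i) (ltn_ord j) (ltn_ord k) (ltn_ord l); lia.
Qed.

Definition cross (i : 'I_N) : {set triangle n n m} :=
  [set (i, rev_ord i, true); (i, rev_ord i, false)].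

Lemma rot_cross i : rot @: cross i = cross (rev_ord i).
Proof. by rewrite /cross imsetU !imset_set1 /rot180 rev_ordK setUC. Qed.

Lemma mem_cross i t : (t \in cross i) = (t.1 == (i, rev_ord i)).
Proof.
by case: t => p []; rewrite !inE ![(p, _) == _]xpair_eqE ?andbT ?andbF ?orbF.
Qed.

Definition low (S : {set 'I_N}) : {set triangle n n m} :=
  region n m N (map val (enum S)) N.+1 N [::].

Lemma mem_low S (t : triangle n n m) : (t \in low S) =
  let: (i, j, up) := t in
  if up then (m <= i + j < N) && ~~ ((j == rev_ord i) && (i \in S))
  else m <= (i + j).+1 < N.
Proof.
case: t => [[i j] []]; rewrite inE; last by have := ltn_ord i; lia.
have -> : ((i : nat) \in map val (enum S)) = (i \in S).
  by rewrite mem_map ?mem_enum //; exact: val_inj.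
rewrite -val_eqE /=; case: (i \in S); have := ltn_ord i; have := ltn_ord j; lia.
Qed.

Lemma mem_hexagon (t : triangle n n m) : (t \in hexagon n n m) =
  let: (i, j, up) := t in
  if up then (m <= i + j) && (i + j < n + N) else (m <= (i + j).+1) && ((i + j).+1 < n + N).
Proof.
case: t => [[i j] []]; rewrite inE /= /in_hexagon /=;
have := ltn_ord i; have := ltn_ord j; lia.
Qed.

Definition crosses (S : {set 'I_N}) := [set cross i | i in S].

Lemma mem_cover_crosses S (t : triangle n n m) :
  (t \in cover (crosses S)) = (t.1.2 == rev_ord t.1.1) && (t.1.1 \in S).
Proof.
rewrite cover_imset; apply/bigcupP/andP => [[i iS]|[/eqP e tS]].
  by rewrite mem_cross => /eqP->.
by exists t.1.1 => //; rewrite mem_cross -e; case: (t.1).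
Qed.

Lemma partition_crosses S : partition (crosses S) (cover (crosses S)).
Proof.
apply/and3P; split=> //; last first.
  by apply/imsetP => -[i _] /setP/(_ (i, rev_ord i, true)); rewrite !inE eqxx.
apply/trivIsetP=> _ _ /imsetP[i _ ->] /imsetP[j _ ->] ij.
rewrite -setI_eq0; apply/eqP/setP => t; rewrite inE !mem_cross inE.
by apply/andP => -[/eqP-> /eqP[eij _]]; move: ij; rewrite eij eqxx.
Qed.

Lemma partitionU (T : finType) (P Q : {set {set T}}) (A B : {set T}) :
  partition P A -> partition Q B -> [disjoint A & B] ->
  partition (P :|: Q) (A :|: B).
Proof.
case/and3P=> /eqP cP tP P0 /and3P[/eqP cQ tQ Q0] dAB.
apply/and3P; split; last by rewrite inE negb_or P0.
  by rewrite /cover bigcup_setU -/(cover P) -/(cover Q) cP cQ.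
by apply: trivIsetU; rewrite ?cP ?cQ.
Qed.

(** By symmetry of [S], the triangles missing from the rotated half belong to the same crossing
    lozenges as those missing from the lower half. *)
Lemma hexagon_split S : 0 < n -> symmetric_set S ->
  hexagon n n m = (low S :|: rot @: low S) :|: cover (crosses S).
Proof.
move=> n0 /forallP sS; apply/setP => t.
rewrite mem_hexagon !in_setU mem_rot !mem_low mem_cover_crosses.
case: t => [[i j] []] /=; rewrite -!val_eqE /= ?(eqP (sS i));
case: (i \in S); have := ltn_ord i; have := ltn_ord j; lia.
Qed.

Lemma low_rot_disjoint S : [disjoint low S & rot @: low S].
Proof.
rewrite -setI_eq0; apply/eqP/setP => t; rewrite in_set0 in_setI mem_rot !mem_low.
case: t => [[i j] []] /=; rewrite -!val_eqE /=; case: (_ \in S);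
  have := ltn_ord i; have := ltn_ord j; lia.
Qed.

Lemma low_cross_disjoint S : symmetric_set S ->
  [disjoint low S :|: rot @: low S & cover (crosses S)].
Proof.
move/forallP=> sS; rewrite -setI_eq0; apply/eqP/setP => t.
rewrite in_set0 in_setI in_setU mem_rot !mem_low mem_cover_crosses.
case: t => [[i j] []] /=; rewrite -!val_eqE /= ?(eqP (sS i));
case: (i \in S); have := ltn_ord i; have := ltn_ord j; lia.
Qed.

(** The axis is a lattice line, so a lozenge straddles it only if the edge common to its two
    triangles lies on it. *)
Lemma lozenge_cases (L : {set triangle n n m}) :
  is_lozenge L -> L \subset hexagon n n m ->
  [\/ L \subset low set0, rot @: L \subset low set0 | exists i, L = cross i].
Proof.
case/existsP=> t' /existsP[u' /andP[tu' /eqP->]].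
have [t [u [tu -> t2 u2]]] : exists t u : triangle n n m,
    [/\ share_edge t u, [set t'; u'] = [set t; u], t.2 = true & u.2 = false].
  have := share_edge_orient tu'; case e: (t'.2) => /= h.
    by exists t', u'.
  by exists u', t'; rewrite share_edgeC setUC.
move=> sub; have th := subsetP sub t (set21 _ _); have uh := subsetP sub u (set22 _ _).
move: tu th uh; rewrite !imsetU !imset_set1 !subUset !sub1set !mem_low !mem_hexagon share_edgeP.
case: t t2 {sub} => [[i j] up] /= ->; case: u u2 => [[k l] up'] /= -> /=.
rewrite !in_set0 !andbF !andbT => tu th uh.
have [hi [hj [hk hl]]] := (ltn_ord i, (ltn_ord j, (ltn_ord k, ltn_ord l))).
have [h1|h1] := boolP ((i + j < N) && ((k + l).+1 < N)).
  by apply: Or31; lia.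
have [h2|h2] := boolP ((i + j >= N) && ((k + l).+1 >= N)).
  by apply: Or32; lia.
apply: Or33; exists i; rewrite /cross.
by congr [set _; _]; congr (_, _, _); apply: val_inj => /=; lia.
Qed.

Lemma low_sub S : low S \subset low set0.
Proof.
apply/subsetP => -[[i j] []]; rewrite !mem_low // in_set0 andbF andbT.
by case/andP.
Qed.

Lemma cross_notin_low i S : ~~ (cross i \subset low S).
Proof.
apply/negP => /subsetP/(_ (i, rev_ord i, false)); rewrite !inE eqxx orbT => /(_ isT).
by have := ltn_ord i; move=> /=; lia.
Qed.

Lemma rot_notin_low (L : {set triangle n n m}) t S S' :
  t \in L -> L \subset low S -> rot @: L \subset low S' -> False.
Proof.
move=> tL /subsetP sL /subsetP sL'.
have := sL _ tL; have := sL' (rot t); rewrite mem_rot rotK tL => /(_ isT).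
have /setP/(_ t) := disjoint_setI0 (low_rot_disjoint set0).
rewrite in_set0 in_setI mem_rot => h h1 h2.
by move: h; rewrite (subsetP (low_sub S) _ h2) (subsetP (low_sub S') _ h1).
Qed.

Definition glue S (T : {set {set triangle n n m}}) :=
  (T :|: rot180_tiling T) :|: crosses S.

Definition rot_invariant (T : {set {set triangle n n m}}) :=
  tiles (hexagon n n m) T && (rot180_tiling T == T).

Definition crossing (T : {set {set triangle n n m}}) := [set i | cross i \in T].

Lemma mem_rot180_tiling (T : {set {set triangle n n m}}) L :
  (L \in rot180_tiling T) = (rot @: L \in T).
Proof.
by rewrite -{1}[L]rot_setK mem_imset //; exact: imset_inj rot_inj.
Qed.

Lemma mem_crosses S i : (cross i \in crosses S) = (i \in S).
Proof.
rewrite mem_imset // => {}i j /setP/(_ (i, rev_ord i, true)).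
by rewrite !mem_cross eqxx => /esym/eqP[].
Qed.

Lemma tiles_inhabited R (T : {set {set triangle n n m}}) L :
  tiles R T -> L \in T -> exists t, t \in L.
Proof. by move=> /tiles_partition/partition_neq0 h /h /set0Pn. Qed.

Lemma glue_low S T : tiles (low S) T -> [set L in glue S T | L \subset low set0] = T.
Proof.
move=> tT; have sT L : L \in T -> L \subset low set0.
  by move=> /(partitionS (tiles_partition tT))/subset_trans; apply; exact: low_sub.
apply/setP => L; rewrite inE !in_setU mem_rot180_tiling.
apply/idP/idP => [/andP[/orP[/orP[//|LT]|/imsetP[i _ ->]] sL]|LT].
- have [t tL] := tiles_inhabited tT LT.
  by case: (rot_notin_low tL (sT _ LT) (S' := set0)); rewrite rot_setK.
- by move: (cross_notin_low i set0); rewrite sL.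
- by rewrite LT sT.
Qed.

Lemma glue_crossing S T : tiles (low S) T -> crossing (glue S T) = S.
Proof.
move=> tT; apply/setP => i; rewrite inE !in_setU mem_rot180_tiling rot_cross mem_crosses.
have nT j : cross j \in T = false.
  apply/negP => /(partitionS (tiles_partition tT)) h.
  by have := cross_notin_low j S; rewrite h.
by rewrite !nT.
Qed.

Lemma glue_invariant S T : 0 < n -> symmetric_set S -> tiles (low S) T ->
  rot_invariant (glue S T).
Proof.
move=> n0 sS tT; have pT := tiles_partition tT; apply/andP; split; last first.
  apply/eqP/setP => L; rewrite mem_rot180_tiling !in_setU !mem_rot180_tiling rot_setK.
  rewrite [X in X || _]orbC; congr (_ || _); apply/idP/idP => [|/imsetP[i iS ->]].
    case/imsetP=> i iS e; rewrite -[L]rot_setK e rot_cross mem_crosses.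
    by have /eqP-> := forallP sS i.
  by rewrite rot_cross mem_crosses; have /eqP-> := forallP sS i.
apply/andP; split.
  apply/forall_inP => L; rewrite !in_setU mem_rot180_tiling.
  case/orP=> [/orP[/(tiles_lozenge tT)//|/(tiles_lozenge tT)/rot_lozenge]|].
    by rewrite rot_setK.
  case/imsetP=> i _ ->; apply: lozenge2.
  by rewrite share_edgeP /= !eqxx.
rewrite (hexagon_split n0 sS); apply: partitionU; last exact: low_cross_disjoint.
  apply: partitionU => //; last exact: low_rot_disjoint.
  by rewrite imset_partition //; exact: rot_inj.
exact: partition_crosses.
Qed.

Lemma crossing_symmetric T : rot_invariant T -> symmetric_set (crossing T).
Proof.
case/andP=> _ /eqP rT; apply/forallP => i; rewrite !inE -rot_cross.
by rewrite -mem_rot180_tiling rT.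
Qed.

Lemma tiles_low T : rot_invariant T ->
  tiles (low (crossing T)) [set L in T | L \subset low set0].
Proof.
case/andP=> tT /eqP rT; have pT := tiles_partition tT.
have tri := partition_trivIset pT.
apply/andP; split.
  by apply/forall_inP => L; rewrite inE => /andP[/(tiles_lozenge tT)].
apply/and3P; split; last first.
- by rewrite inE (partition0 pT).
- by apply: trivIsetS tri; apply/subsetP => L; rewrite inE => /andP[].
apply/eqP/setP => t; apply/bigcupP/idP => [[L]|tl].
  rewrite inE => /andP[LT sL] tL; have := subsetP sL _ tL.
  rewrite !mem_low; case: t tL => [[i j] []] tL //; rewrite in_set0 andbF andbT => ->.
  apply/negP => /andP[/eqP ej]; rewrite inE => iT.
  have ti : (i, j, true) \in cross i by rewrite ej !inE eqxx.
  have eL := def_pblock tri LT tL; rewrite (def_pblock tri iT ti) in eL.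
  by have := cross_notin_low i set0; rewrite eL sL.
have tl0 := subsetP (low_sub _) _ tl.
have : t \in cover T.
  rewrite (cover_partition pT) mem_hexagon; move: tl0; rewrite mem_low.
  by case: t {tl} => [[i j] []]; lia.
case/bigcupP=> L LT tL.
have [sL|sL|[i eL]] := lozenge_cases (tiles_lozenge tT LT) (partitionS pT LT).
- by exists L => //; rewrite inE LT.
- case: (@rot_notin_low [set t] t set0 set0); rewrite ?set11 ?sub1set //.
  by rewrite imset_set1 sub1set (subsetP sL) // mem_rot rotK.
- move: tL tl; rewrite eL mem_cross mem_low; case: t {tl0} => [[k l] []] /= /eqP[-> ->].
    by rewrite inE -eL LT eqxx andbF.
  by have := ltn_ord i; move=> /=; lia.
Qed.

Lemma glueK T : rot_invariant T ->
  glue (crossing T) [set L in T | L \subset low set0] = T.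
Proof.
case/andP=> tT /eqP rT; have pT := tiles_partition tT.
have rTE (L : {set triangle n n m}) : (rot @: L \in T) = (L \in T) by rewrite -mem_rot180_tiling rT.
apply/setP => L; rewrite !in_setU mem_rot180_tiling !inE rTE.
apply/idP/idP => [/orP[/orP[/andP[]//|/andP[]//]|/imsetP[i]]|LT].
  by rewrite inE => iT ->.
rewrite LT /=.
have [->//|->|[i eL]] := lozenge_cases (tiles_lozenge tT LT) (partitionS pT LT).
  by rewrite orbT.
by rewrite eL mem_crosses inE -eL LT orbT.
Qed.

(** [glue S] is inverted by keeping the lozenges below the axis. The size of [S] is left free: sets
    of the wrong size admit no tiling and drop out in [SC_moment]. *)
Lemma SC_tilings : 0 < n -> SC n n m = \sum_(S | symmetric_set S) tilings (low S).
Proof.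
move=> n0; have -> : SC n n m = #|[set T | rot_invariant T]| by [].
rewrite -sum1_card (partition_big crossing (@symmetric_set _)) /=; last first.
  by move=> T; rewrite inE; exact: crossing_symmetric.
apply: eq_bigr => S sS; rewrite sum1_card /tilings.
have inj : {in [set T | tiles (low S) T] &, injective (glue S)}.
  by move=> T T' /[!inE] tT tT' e; rewrite -(glue_low tT) e glue_low.
rewrite -(card_in_imset inj); apply: eq_card => T.
rewrite [LHS]unfold_in inE; apply/andP/imsetP => [[iT /eqP<-]|[T']].
  exists [set L in T | L \subset low set0]; last by rewrite glueK.
  by rewrite inE tiles_low.
by rewrite inE => tT ->; rewrite glue_invariant // glue_crossing.
Qed.

End CentralSymmetry.
Local Open Scope ring_scope.

(** * Vandermonde products and Andreief's identity *)

Section Vandermonde.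
Variable R : comNzRingType.
Implicit Types (s : seq R) (P Q : nat -> {poly R}).

Fixpoint vdm s : R := if s is x :: s' then \prod_(y <- s') (y - x) * vdm s' else 1.

Lemma vdmE s :
  vdm s = \prod_(i < size s) \prod_(j < size s | (i < j)%N) (s`_j - s`_i).
Proof.
elim: s => [|x s IH]; first by rewrite big_ord0.
rewrite /= big_ord_recl /= IH; congr (_ * _).
  rewrite [RHS]big_mkcond big_ord_recl /= mul1r big_tnth.
  by apply: eq_bigr => i _; rewrite (tnth_nth 0).
apply: eq_bigr => i _; rewrite [RHS]big_mkcond big_ord_recl /= mul1r [LHS]big_mkcond.
by apply: eq_bigr => j _.
Qed.

(** The change of basis from powers to monic polynomials of degrees 0, 1, 2, ... is
    unitriangular. *)
Lemma det_monic_vdm k s P : size s = k ->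
  (forall r, P r \is monic) -> (forall r, size (P r) = r.+1) ->
  \det (\matrix_(j < k, r < k) (P r).[s`_j]) = vdm s.
Proof.
move=> sk Pm Ps.
pose U := \matrix_(l < k, r < k) (P r)`_l.
have -> : \matrix_(j < k, r < k) (P r).[s`_j] = (Vandermonde k (\row_j s`_j))^T *m U.
  apply/matrixP=> j r; rewrite !mxE (horner_coef_wide _ (n := k)) ?Ps //.
  by apply: eq_bigr => l _; rewrite !mxE mulrC.
rewrite det_mulmx det_tr det_Vandermonde -[\det U]det_tr det_trig; last first.
  by apply/is_trig_mxP => i j ij; rewrite !mxE nth_default // Ps.
rewrite [X in _ * X]big1 ?mulr1 => [|i _]; last first.
  by rewrite !mxE; have := monicP (Pm i); rewrite lead_coefE Ps.
rewrite vdmE sk; apply: eq_bigr => i _; apply: eq_bigr => j _; by rewrite !mxE.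
Qed.

Lemma vdm_cat s1 s2 :
  vdm (s1 ++ s2) = vdm s1 * vdm s2 * \prod_(x <- s1) \prod_(y <- s2) (y - x).
Proof.
elim: s1 => [|x s1 IH] /=; first by rewrite big_nil mulr1 mul1r.
by rewrite IH big_cat big_cons /=; ring.
Qed.

Lemma vdm_translate (u : R) s : vdm [seq x - u | x <- s] = vdm s.
Proof.
elim: s => //= x s ->; rewrite big_map; congr (_ * _).
by apply: eq_bigr => y _; ring.
Qed.

Lemma vdm_rev_opp s : vdm (rev [seq - x | x <- s]) = vdm s.
Proof.
elim: s => //= x s IH; rewrite rev_cons -cats1 vdm_cat IH /= big_nil !mulr1 mulrC.
rewrite big_rev big_map; congr (_ * _); apply: eq_bigr => y _.
by rewrite big_seq1; ring.
Qed.

Lemma prod_cat_inner s s1 s2 (f : R -> R -> R) :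
  \prod_(x <- s) \prod_(y <- s1 ++ s2) f x y =
  \prod_(x <- s) \prod_(y <- s1) f x y * \prod_(x <- s) \prod_(y <- s2) f x y.
Proof. by rewrite -big_split; apply: eq_bigr => x _; rewrite big_cat. Qed.

(** Exchanging two blocks only changes signs of factors, which the square absorbs. *)
Lemma vdm_sqr_perm s1 s2 : perm_eq s1 s2 -> vdm s1 ^+ 2 = vdm s2 ^+ 2.
Proof.
move=> p; apply: (catCA_perm_ind (P := fun s => vdm s1 ^+ 2 = vdm s ^+ 2)) p _ => //.
move=> a b c ->; rewrite !vdm_cat !prod_cat_inner !exprMn.
have -> : (\prod_(x <- a) \prod_(y <- b) (y - x)) ^+ 2 =
  (\prod_(x <- b) \prod_(y <- a) (y - x)) ^+ 2.
  rewrite exchange_big /= -!prodrXl; apply: eq_bigr => i _.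
  by rewrite -!prodrXl; apply: eq_bigr => j _; ring.
by ring.
Qed.

(** The pairs x = y give the factors 2x; each other pair gives (y - x)^2 (x + y)^2 = (y^2 -
    x^2)^2. *)
Lemma vdm_sqr_sum s :
  vdm s ^+ 2 * \prod_(x <- s) \prod_(y <- s) (x + y) =
  \prod_(x <- s) (2 * x) * vdm [seq x ^+ 2 | x <- s] ^+ 2.
Proof.
elim: s => [|x s IH] /=; first by rewrite !big_nil !mul1r mulr1.
rewrite !big_cons big_map.
under [X in _ * (_ * X)]eq_bigr do rewrite big_cons.
rewrite big_split /=.
have -> : \prod_(y <- s) (y ^+ 2 - x ^+ 2) =
    \prod_(y <- s) (y - x) * \prod_(y <- s) (y + x).
  by rewrite -big_split /=; apply: eq_bigr => y _; ring.
have -> : \prod_(y <- s) (x + y) = \prod_(y <- s) (y + x).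
  by apply: eq_bigr => y _; rewrite addrC.
rewrite [RHS](_ : _ = 2 * x * (\prod_(y <- s) (y - x) * \prod_(y <- s) (y + x)) ^+ 2
  * (\prod_(x <- s) (2 * x) * vdm [seq x ^+ 2 | x <- s] ^+ 2)); last by ring.
by rewrite -IH; ring.
Qed.

(** Each half contributes [vdm s], the factors between -x and y contribute all sums x + y, and a
    central 0 contributes each x twice; [vdm_sqr_sum] concludes. *)
Lemma vdm_symmetric (b : bool) s :
  vdm (rev [seq - x | x <- s] ++ nseq b 0 ++ s) =
  \prod_(x <- s) (2 * x * (x ^+ 2) ^+ b) * vdm [seq x ^+ 2 | x <- s] ^+ 2.
Proof.
rewrite big_split /= mulrAC -vdm_sqr_sum !vdm_cat vdm_rev_opp big_rev big_map.
have cross u : \prod_(x <- s) \prod_(y <- u ++ s) (y - - x) =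
   \prod_(x <- s) \prod_(y <- u) (x + y) * \prod_(x <- s) \prod_(y <- s) (x + y).
  rewrite -big_split; apply: eq_bigr => x _ /=; rewrite big_cat /=.
  by congr (_ * _); apply: eq_bigr => y _; rewrite opprK addrC.
rewrite cross; case: b => /=.
  have -> : \prod_(x <- s) \prod_(y <- [:: 0]) (x + y) = \prod_(x <- s) x.
    by apply: eq_bigr => x _; rewrite big_seq1 addr0.
  have -> : \prod_(x <- s) (x ^+ 2) ^+ 1 = (\prod_(x <- s) x) ^+ 2.
    by rewrite -prodrXl.
  have -> : \prod_(x <- [:: 0]) \prod_(y <- s) (y - x) = \prod_(x <- s) x.
    by rewrite big_seq1; apply: eq_bigr => x _; rewrite subr0.
  by rewrite big_nil; ring.
have -> : \prod_(x <- s) \prod_(y <- [::]) (x + y) = 1 by rewrite big1 // => x _; rewrite big_nil.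
by rewrite big_nil [X in _ = _ * X]big1 => [|x _]; [ring | rewrite expr0].
Qed.

(** Expand the first determinant over permutations and reindex [f] by the permutation: the sign
    cancels against that of the second determinant, so all x! terms are equal. *)
Lemma andreief x M (w : 'I_M -> R) (a b : 'I_x -> 'I_M -> R) :
  \sum_(f : {ffun 'I_x -> 'I_M}) \prod_j w (f j) *
     (\det (\matrix_(j, r) a r (f j)) * \det (\matrix_(j, r) b r (f j))) =
  x`!%:R * \det (\matrix_(i, j) \sum_t w t * a i t * b j t).
Proof.
pose B (f : {ffun 'I_x -> 'I_M}) := \det (\matrix_(j < x, r < x) b r (f j)).
have eq_s (s : 'S_x) : \sum_(f : {ffun 'I_x -> 'I_M})
    \prod_j w (f j) * ((-1) ^+ s * \prod_j a (s j) (f j) * B f) =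
    \det (\matrix_(i, j) \sum_t w t * a i t * b j t).
  transitivity (\sum_(f : {ffun 'I_x -> 'I_M}) \prod_j (w (f j) * a j (f j)) * B f).
    rewrite (reindex_inj (h := fun f : {ffun 'I_x -> 'I_M} => [ffun j => f (s j)])) /=; last first.
      move=> f g /ffunP e; apply/ffunP => j; have := e ((s^-1)%g j).
      by rewrite !ffunE permKV.
    apply: eq_bigr => f _; rewrite big_split /=.
    have -> : \prod_j w ([ffun j => f (s j)] j) = \prod_j w (f j).
      rewrite [RHS](reindex_inj (@perm_inj _ s)) /=.
      by apply: eq_bigr => j _; rewrite ffunE.
    have -> : \prod_j a (s j) ([ffun j => f (s j)] j) = \prod_j a j (f j).
      rewrite [RHS](reindex_inj (@perm_inj _ s)) /=.
      by apply: eq_bigr => j _; rewrite ffunE.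
    have -> : B [ffun j => f (s j)] = (-1) ^+ s * B f.
      rewrite /B (_ : \matrix_(j, r) _ = row_perm s (\matrix_(j < x, r < x) b r (f j))).
        by rewrite row_permE det_mulmx det_perm.
      by apply/matrixP=> j r; rewrite !mxE ffunE.
    rewrite -!mulrA; congr (_ * _); rewrite mulrCA; congr (_ * _).
    by rewrite mulrA -signr_addb addbb mul1r.
  rewrite /determinant; under eq_bigr do rewrite big_distrr /=.
  rewrite exchange_big /=; apply: eq_bigr => t _.
  under [X in _ = _ * X]eq_bigr do rewrite mxE.
  rewrite bigA_distr_bigA big_distrr /=; apply: eq_bigr => f _.
  rewrite mulrCA; congr (_ * _); rewrite -big_split /=.
  by apply: eq_bigr => j _; rewrite mxE.
transitivity (\sum_(s : 'S_x) \sum_(f : {ffun 'I_x -> 'I_M})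
    \prod_j w (f j) * ((-1) ^+ s * \prod_j a (s j) (f j) * B f)).
  rewrite exchange_big /=; apply: eq_bigr => f _.
  rewrite -big_distrr /= -big_distrl /=; congr (_ * (_ * _)).
  by apply: eq_bigr => s _; congr (_ * _); apply: eq_bigr => j _; rewrite mxE.
under eq_bigr do rewrite eq_s.
by rewrite sumr_const mulr_natl -card_Sn.
Qed.

End Vandermonde.

Section SubsetSum.
Variable R : numDomainType.

(** A set of size x is the image of x! injective maps, and a map that is not injective gives a
    determinant with two equal rows. The independence of [P] and [Q] is exploited in [moment]. *)
Lemma sum_vdm_sqr x M (w z : 'I_M -> R) (P Q : nat -> {poly R}) :
  (forall r, P r \is monic) -> (forall r, size (P r) = r.+1) ->
  (forall r, Q r \is monic) -> (forall r, size (Q r) = r.+1) ->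
  \sum_(T : {set 'I_M} | #|T| == x)
     \prod_(t <- enum T) w t * vdm [seq z t | t <- enum T] ^+ 2 =
  \det (\matrix_(i < x, j < x) \sum_t w t * (P i).[z t] * (Q j).[z t]).
Proof.
move=> Pm Ps Qm Qs.
have x0 : x`!%:R != 0 :> R by rewrite pnatr_eq0 -lt0n fact_gt0.
apply: (mulfI x0).
rewrite -(andreief w (fun r t => (P r).[z t]) (fun r t => (Q r).[z t])).
pose G (f : {ffun 'I_x -> 'I_M}) := \prod_j w (f j) * vdm [seq z (f j) | j <- enum 'I_x] ^+ 2.
have detE (f : {ffun 'I_x -> 'I_M}) P0 :
    (forall r, P0 r \is monic) -> (forall r, size (P0 r) = r.+1) ->
   \det (\matrix_(j < x, r < x) (P0 r).[z (f j)]) = vdm [seq z (f j) | j <- enum 'I_x].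
  move=> Pm0 Ps0; 
  have sz : size [seq z (f j) | j <- enum 'I_x] = x by rewrite size_map size_enum_ord.
  rewrite -(det_monic_vdm sz Pm0 Ps0).
  by congr (\det _); apply/matrixP => j r; rewrite !mxE (nth_map j) ?size_enum_ord ?nth_ord_enum.
transitivity (\sum_f G f); last by apply: eq_bigr => f _; rewrite !detE // expr2.
rewrite [RHS](bigID (fun f : {ffun 'I_x -> 'I_M} => injectiveb f)) /=
  [X in _ = _ + X]big1 ?addr0; last first.
  move=> f /injectivePn[i [j ij fij]]; rewrite /G -(detE f P) //.
  by rewrite (determinant_alternate ij) ?expr0n ?mulr0 // => r; rewrite !mxE fij.
rewrite [RHS](partition_big (fun f : {ffun 'I_x -> 'I_M} => f @: setT)
  (fun T => #|T| == x)) /=; last first.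
  by move=> f /injectiveP fi; rewrite card_imset // cardsT card_ord.
rewrite big_distrr; apply: eq_bigr => T /eqP cT /=.
pose A := [set f : {ffun 'I_x -> 'I_M} in ffun_on (mem T) | injectiveb f].
have cA : #|A| = x`! by rewrite /A card_inj_ffuns_on card_ord cT ffactnn.
have AE f : (f \in A) = injectiveb f && (f @: setT == T).
  rewrite inE andbC; case: (boolP (injectiveb f)) => //= /injectiveP fi.
  apply/ffun_onP/eqP => [fT|<- j]; last exact: imset_f.
  apply/eqP; rewrite eqEcard card_imset // cardsT card_ord cT leqnn andbT.
  by apply/subsetP=> _ /imsetP[j _ ->]; exact: fT.
rewrite -(eq_bigl _ _ AE) mulr_natl -cA -sumr_const; apply: eq_bigr => f.
rewrite AE => /andP[/injectiveP fi /eqP fT].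
have p : perm_eq (enum T) [seq f j | j <- enum 'I_x].
  apply: uniq_perm => [||t]; first exact: enum_uniq.
    by rewrite map_inj_uniq ?enum_uniq.
  rewrite mem_enum -fT; apply/imsetP/mapP => -[j _ ->]; exists j => //.
  by rewrite mem_enum.
rewrite (perm_big _ p) /= big_map big_enum /=; congr (_ * _).
by rewrite (vdm_sqr_perm (perm_map z p)) -map_comp.
Qed.

End SubsetSum.


Local Close Scope ring_scope.

Notation vals S := [seq val i | i <- enum S].

Lemma mem_vals N (S : {set 'I_N}) (i : 'I_N) : ((i : nat) \in vals S) = (i \in S).
Proof. by rewrite mem_map ?mem_enum //; exact: val_inj. Qed.

Lemma vals_lt N (S : {set 'I_N}) v : v \in vals S -> v < N.
Proof. by case/mapP=> i _ ->; exact: ltn_ord. Qed.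

Lemma sorted_vals N (S : {set 'I_N}) : sorted ltn (vals S).
Proof.
rewrite sorted_map {1}/enum_mem -enumT; apply: sorted_filter.
  by move=> j i k /=; exact: ltn_trans.
by rewrite -sorted_map val_enum_ord iota_ltn_sorted.
Qed.

(** * Symmetric sets *)

Section SymmetricSets.
Variables (N M : nat) (e : bool).
Hypothesis NE : N = M + e + M.
Implicit Types (b : bool) (t : seq nat) (S : {set 'I_N}) (T : {set 'I_M}).

(* The symmetric set with upper half M + e + t; the centre of 'I_N is an integer,   *)
(* namely M, if e holds, and b tells whether it belongs to the set.                 *)
Definition symseq b t :=
  rev [seq M.-1 - v | v <- t] ++ nseq b M ++ [seq M + e + v | v <- t].

Lemma mem_symseq b t v : b ==> e -> {in t, forall v, v < M} -> v < N ->
  (v \in symseq b t) =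
  if v < M then M.-1 - v \in t
  else if (v == M) && e then b else v - (M + e) \in t.
Proof.
move=> be tM vN; rewrite !mem_cat mem_rev mem_nseq.
have -> : (v \in [seq M.-1 - v | v <- t]) = (v < M) && (M.-1 - v \in t).
  apply/mapP/andP => [[w wt ->]|[vM vt]].
    by have wM := tM w wt; rewrite (_ : M.-1 - (M.-1 - w) = w) ?wt; lia.
  by exists (M.-1 - v) => //; lia.
have -> : (v \in [seq M + e + v | v <- t]) = (M + e <= v) && (v - (M + e) \in t).
  apply/mapP/andP => [[w wt ->]|[vM vt]]; first by rewrite addKn wt; lia.
  by exists (v - (M + e)) => //; lia.
case: (M.-1 - v \in t); case: (v - (M + e) \in t); move: be;
  case: b; case: (e) => //= _; case: (ltngtP v M) => /= ?; lia.
Qed.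

Lemma sorted_symseq b t : b ==> e -> {in t, forall v, v < M} ->
  sorted ltn t -> sorted ltn (symseq b t).
Proof.
move=> be tM st.
have rM u : u \in rev [seq M.-1 - v | v <- t] -> u < M.
  by rewrite mem_rev => /mapP[w /tM wM ->]; lia.
rewrite (sorted_pairwise ltn_trans) !pairwise_cat; apply/and5P; split.
- apply/allrelP => u v /rM uM; rewrite mem_cat mem_nseq => /orP[|/mapP[w _ ->]] /=; lia.
- rewrite -(sorted_pairwise ltn_trans) rev_sorted sorted_map.
  apply: (sub_in_sorted _ (allss t) st) => u v ut vt /= uv.
  by have := tM u ut; have := tM v vt; lia.
- apply/allrelP => u v; rewrite mem_nseq => /andP[b1 /eqP->] /mapP[w _ ->] /=.
  by move: be b1; case: b => //=; case: (e) => // _ _; lia.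
- by case: (b).
- rewrite -(sorted_pairwise ltn_trans) sorted_map.
  by apply: (sub_sorted _ st) => u v /=; rewrite ltn_add2l.
Qed.

Definition from_upper b T : {set 'I_N} :=
  [set i : 'I_N | (i : nat) \in symseq b (vals T)].

Definition upper S : {set 'I_M} := [set t : 'I_M | M + e + t \in vals S].

Lemma vals_from_upper b T : b ==> e -> vals (from_upper b T) = symseq b (vals T).
Proof.
move=> be; have tM := @vals_lt _ T.
apply: (irr_sorted_eq ltn_trans ltnn); [exact: sorted_vals | exact: sorted_symseq (sorted_vals T)|].
move=> v; have [vN|vN] := ltnP v N.
  by rewrite -[v]/(nat_of_ord (Ordinal vN)) mem_vals inE.
transitivity false; first by apply/negP => /vals_lt; lia.
apply/esym/negP; rewrite !mem_cat mem_rev mem_nseq => 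
  /or3P[/mapP[w /tM]|/andP[b1 /eqP]|/mapP[w /tM]].
- lia.
- by move: be b1 NE; case: b => //=; case: (e) => //= _ _; lia.
- lia.
Qed.

Lemma card_from_upper b T : b ==> e -> #|from_upper b T| = 2 * #|T| + b.
Proof.
move=> be; rewrite cardE -(size_map val) vals_from_upper // !size_cat size_rev.
by rewrite size_nseq !size_map -cardE addnCA addnC addnn mul2n.
Qed.

Lemma mem_vals_upper S v : (v \in vals (upper S)) = (M + e + v \in vals S).
Proof.
have [vM|vM] := ltnP v M.
  by rewrite -[v]/(nat_of_ord (Ordinal vM)) mem_vals inE.
by apply/idP/idP => /vals_lt; lia.
Qed.

Lemma upperK b T : b ==> e -> upper (from_upper b T) = T.
Proof.
move=> be; apply/setP => t; rewrite -!mem_vals mem_vals_upper vals_from_upper //.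
have tM := ltn_ord t; rewrite mem_symseq //; last 2 first.
- exact: vals_lt.
- lia.
have -> : (M + e + t < M) = false by lia.
have -> : (M + e + t == M) && e = false by case: (e); lia.
by rewrite addKn.
Qed.

Lemma from_upper_symmetric b T : b ==> e -> symmetric_set (from_upper b T).
Proof.
move=> be; apply/forallP => i; apply/eqP; rewrite -!mem_vals vals_from_upper //=.
have iN := ltn_ord i; rewrite !mem_symseq //; try (exact: vals_lt); last by lia.
have [vM|vM] := ltnP i M.
  have -> : (N - i.+1 < M) = false by lia.
  have -> : (N - i.+1 == M) && e = false by case: (e) NE => /=; lia.
  by have -> : N - i.+1 - (M + e) = M.-1 - i by lia.
have [iM|iM] := eqVneq (i : nat) M => /=.
  have [ee|ee] := boolP e.
    have -> : (N - i.+1 < M) = false by lia.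
    by have -> : (N - i.+1 == M) by lia.
  have -> : N - i.+1 < M by lia.
  by have -> : i - (M + false) = M.-1 - (N - i.+1) by lia.
have -> : N - i.+1 < M by lia.
by have -> : i - (M + e) = M.-1 - (N - i.+1) by lia.
Qed.

Lemma from_upperK S : symmetric_set S -> from_upper (e && (M \in vals S)) (upper S) = S.
Proof.
move=> /forallP sS; have be : e && (M \in vals S) ==> e by case: (e); rewrite ?implybT.
apply/setP => i; rewrite -!mem_vals vals_from_upper //.
have iN := ltn_ord i; rewrite mem_symseq //; try exact: vals_lt.
rewrite !mem_vals_upper.
have [vM|vM] := ltnP i M.
  rewrite [RHS]mem_vals -(eqP (sS i)) -mem_vals /=.
  by have -> : M + e + (M.-1 - i) = N - i.+1 by lia.
case: eqP => [iM|iM] /=.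
  have [ee|ee] := boolP e; first by rewrite iM.
  by have -> : M + false + (i - (M + false)) = i by lia.
by have -> : M + e + (i - (M + e)) = i by lia.
Qed.

(** The parity of the size of [S] decides whether the centre belongs to it, so [upper] and
    [from_upper b] are inverse bijections. *)
Lemma sum_symmetric (V : nmodType) (x : nat) b (F : seq nat -> V) : b ==> e ->
  (\sum_(S : {set 'I_N} | symmetric_set S && (#|S| == 2 * x + b)%N) F (vals S) =
   \sum_(T : {set 'I_M} | #|T| == x) F (symseq b (vals T)))%R.
Proof.
move=> be; rewrite (reindex_onto (from_upper b) upper) /=; last first.
  move=> S /andP[sS /eqP cS]; have := card_from_upper (upper S) (b := e && (M \in vals S)).
  rewrite from_upperK // cS => /(_ ltac:(by case: (e); rewrite ?implybT)) eb.
  rewrite (_ : b = e && (M \in vals S)) ?from_upperK //.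
  by move: eb; case: (b); case: (e && _) => //=; lia.
apply: eq_big => [T|T _]; last by rewrite vals_from_upper.
rewrite from_upper_symmetric // upperK // eqxx andbT card_from_upper //.
by rewrite [LHS]eqn_add2r eqn_mul2l.
Qed.

End SymmetricSets.

Local Open Scope ring_scope.

(* The distance of the position M + e + v to the centre (N - 1) / 2. *)
Definition offset (e : bool) (v : nat) : rat := v%:R + (1 + e%:R) / 2.

Lemma vdm_symseq M (e b : bool) t : b ==> e -> {in t, forall v, v < M}%N ->
  vdm [seq v%:R : rat | v <- symseq M e b t] =
  \prod_(v <- t) (2 * offset e v * (offset e v ^+ 2) ^+ b) *
  vdm [seq offset e v ^+ 2 | v <- t] ^+ 2.
Proof.
move=> be tM; have := vdm_symmetric b [seq offset e v | v <- t].
have -> : [seq offset e v ^+ 2 | v <- t] = [seq x ^+ 2 | x <- map (offset e) t].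
  by rewrite -map_comp.
rewrite big_map => <-.
(* M + (e - 1) / 2 is the centre (N - 1) / 2 of the positions. *)
rewrite -(vdm_translate (M%:R + (e%:R - 1) / 2)); congr vdm.
rewrite /symseq !map_cat -!map_comp !map_rev -!map_comp; congr (rev _ ++ (_ ++ _)).
- apply/eq_in_map => v /tM vM /=.
  have -> : (M%:R : rat) = (M.-1 - v)%:R + v%:R + 1.
    by rewrite -natrD natr1; congr (_%:R); lia.
  by rewrite /offset; field.
- case: b be => //=; case: e => // _; by rewrite mulr1n subrr mul0r addr0 subrr.
- by apply/eq_in_map => v _ /=; rewrite /offset !natrD; field.
Qed.

(** * Evaluation of the moment determinant *)

Section Moments.
Variables e b : bool.
Hypothesis be : b ==> e.
Notation z := (offset e).

(** Newton basis at consecutive nodes z_m^2, z_(m+1)^2, ...; it is used with m = 0 for rows and m =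
    M for columns. *)
Definition node_poly (m k : nat) : {poly rat} :=
  \prod_(0 <= l < k) ('X - (z (m + l) ^+ 2)%:P).

Lemma node_polyS m k : node_poly m k.+1 = node_poly m k * ('X - (z (m + k) ^+ 2)%:P).
Proof. by rewrite /node_poly big_nat_recr. Qed.

Lemma monic_node_poly m k : node_poly m k \is monic.
Proof. by apply: monic_prod => l _; exact: monicXsubC. Qed.

Lemma size_node_poly m k : size (node_poly m k) = k.+1.
Proof. by rewrite /node_poly size_prod_XsubC size_iota subn0. Qed.

Lemma node_poly0 m x : (node_poly m 0).[x] = 1.
Proof. by rewrite /node_poly big_nil hornerC. Qed.

Lemma horner_node_polyS m k t : (node_poly m k.+1).[z t ^+ 2] =
  (node_poly m k).[z t ^+ 2] * ((t%:R - (m + k)%:R) * (t%:R + (m + k)%:R + 1 + e%:R)).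
Proof.
by rewrite node_polyS hornerM hornerXsubC; congr (_ * _); rewrite /offset; field.
Qed.

Definition weight t : rat := 2 * z t * (z t ^+ 2) ^+ b.

Definition moment M i j : rat :=
  \sum_(t < M) weight t * (node_poly 0 i).[z t ^+ 2] * (node_poly M j).[z t ^+ 2].

(* (X - z_(M+j)^2) - (X - z_i^2) is a constant. *)
Lemma moment_recr M i j : moment M i j.+1 = moment M i.+1 j +
  (i%:R - (M + j)%:R) * (i%:R + (M + j)%:R + 1 + e%:R) * moment M i j.
Proof.
rewrite /moment big_distrr -big_split; apply: eq_bigr => t _ /=.
by rewrite !horner_node_polyS add0n; ring.
Qed.

(** The ratio of the values at consecutive nodes, with denominators cleared because M + 1 - i may
    vanish. *)
Lemma node_poly_succ M i :
  (M%:R + 1 - i%:R) * (M%:R + 1 + e%:R) * (node_poly 0 i).[z M.+1 ^+ 2] =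
  (M%:R + 1) * (M%:R + i%:R + 1 + e%:R) * (node_poly 0 i).[z M ^+ 2].
Proof.
elim: i => [|i IH]; first by rewrite !node_poly0; ring.
rewrite !horner_node_polyS add0n -!natr1.
rewrite [LHS](_ : _ = (M%:R - i%:R) * (M%:R + 1 + i%:R + 1 + e%:R) *
  ((M%:R + 1 - i%:R) * (M%:R + 1 + e%:R) * (node_poly 0 i).[z M.+1 ^+ 2])); last by ring.
by rewrite IH; ring.
Qed.

(** The summand is the increment in M of the right-hand side. At M = 0 the latter vanishes, through
    M - i if i = 0 and through the node z_0 otherwise. *)
Lemma moment0 M i : moment M i 0 =
  (M%:R - i%:R) * (M%:R + e%:R) * (M%:R * (M%:R + 1)) ^+ b / (i%:R + 1 + b%:R)
  * (node_poly 0 i).[z M ^+ 2].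
Proof.
have -> : moment M i 0 = \sum_(t < M) weight t * (node_poly 0 i).[z t ^+ 2].
  by apply: eq_bigr => t _; rewrite node_poly0 mulr1.
have i0 : i%:R + 1 + b%:R != 0 :> rat by rewrite natr1 -natrD pnatr_eq0.
elim: M => [|M IH].
  rewrite big_ord0; case: i {i0} => [|i]; first by rewrite subrr !mul0r.
  by rewrite /node_poly big_nat_recl // hornerM hornerXsubC addn0 subrr [X in _ * X]mul0r mulr0.
rewrite big_ord_recr /= IH /weight -![M.+1%:R]natr1.
rewrite [RHS](_ : _ = (M%:R + 1 + e%:R)^-1 * (M%:R + 1 + e%:R) *
  ((M%:R + 1) * (M%:R + 1 + 1)) ^+ b / (i%:R + 1 + b%:R) *
  ((M%:R + 1 - i%:R) * (M%:R + 1 + e%:R) * (node_poly 0 i).[z M.+1 ^+ 2])); last first.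
  have M1 : M%:R + 1 + e%:R != 0 :> rat by rewrite natr1 -natrD pnatr_eq0.
  by move: (_ ^+ b) => B; field; rewrite i0.
rewrite node_poly_succ mulVf; last by rewrite natr1 -natrD pnatr_eq0.
move: (node_poly 0 i).[_] => p; rewrite /offset.
have i1 : i%:R + 1 != 0 :> rat by rewrite natr1 pnatr_eq0.
have i2 : i%:R + 1 + 1 != 0 :> rat by rewrite !natr1 pnatr_eq0.
by move: be; case: (b); case: (e) => //= _; field; rewrite ?i1 ?i2.
Qed.

Lemma ffactrS n k : (n ^_ k.+1)%:R = (n ^_ k)%:R * (n%:R - k%:R) :> rat.
Proof.
rewrite ffactnSr natrM; have [kn|kn] := leqP k n; first by rewrite natrB.
by rewrite ffact_small // !mul0r.
Qed.

Definition factr n : rat := n`!%:R.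

Lemma factrS n : factr n.+1 = (n%:R + 1) * factr n.
Proof. by rewrite /factr factS natrM natr1. Qed.

Lemma factr_neq0 n : factr n != 0.
Proof. by rewrite /factr pnatr_eq0 -lt0n fact_gt0. Qed.

(** The factor L + 1 - i comes from [moment0] at M = L + 1; keeping it turns the falling factorial
    of L + 1 into that of L without a division. *)
Lemma node_poly_top L i : (L%:R + 1 - i%:R) * (node_poly 0 i).[z L.+1 ^+ 2] =
  (L%:R + 1) * (L ^_ i)%:R * factr (L.+1 + e + i) / factr (L.+1 + e).
Proof.
have f0 := factr_neq0 (L.+1 + e).
elim: i => [|i IH]; first by rewrite node_poly0 addn0 ffactn0; field.
rewrite horner_node_polyS add0n ffactrS addnS factrS.
rewrite -[L.+1%:R]natr1 -[i.+1%:R]natr1.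
rewrite [LHS](_ : _ = ((L%:R + 1 - i%:R) * (node_poly 0 i).[z L.+1 ^+ 2]) *
  ((L%:R - i%:R) * (L%:R + 1 + i%:R + 1 + e%:R))); last by ring.
rewrite IH !natrD -![L.+1%:R]natr1.
by field.
Qed.

(** Up to factors in i alone or j alone, this is (L + i + j + e + 1)! / (i + j + b + 1)!, the shape
    needed for [det_hankel_factr]. *)
Definition moment_value L i j : rat :=
  (-1) ^+ j * factr (i + b) * factr j / factr (i + j + b).+1 *
  factr (L + i + j + e).+1 * factr (L + j + b).+1 * (L ^_ i)%:R
  / (factr (L + e - b) * factr L).

Lemma momentE L i j : moment L.+1 i j = moment_value L i j.
Proof.
elim: j i => [|j IH] i.
  have i0 : i%:R + 1 + b%:R != 0 :> rat by rewrite natr1 -natrD pnatr_eq0.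
  rewrite moment0 -[L.+1%:R]natr1.
  rewrite [LHS](_ : _ = ((L%:R + 1 - i%:R) * (node_poly 0 i).[z L.+1 ^+ 2]) *
    ((L%:R + 1 + e%:R) * ((L%:R + 1) * (L%:R + 1 + 1)) ^+ b / (i%:R + 1 + b%:R))); last by field.
  rewrite node_poly_top /moment_value.
  have i1 : i%:R + 1 != 0 :> rat by rewrite natr1 pnatr_eq0.
  have i2 : i%:R + 1 + 1 != 0 :> rat by rewrite !natr1 pnatr_eq0.
  have L1 : L%:R + 1 != 0 :> rat by rewrite natr1 pnatr_eq0.
  have L2 : L%:R + 1 + 1 != 0 :> rat by rewrite !natr1 pnatr_eq0.
  have [fi fL] := (factr_neq0 i, factr_neq0 L).
  have f0 : factr 0 = 1 by [].
  have [tE fE] : (nat_of_bool true = 1 /\ nat_of_bool false = 0)%N by [].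
  move: be; case: (b); case: (e) => // _; rewrite ?tE ?fE
    ?addn0 ?addn1 ?subn0 ?subn1 !addSn -?pred_Sn ?factrS ?f0 ?expr0 ?expr1 -?[_.+1%:R]natr1 ?natrD
    ?mulr0n ?mulr1n;
  field; by rewrite ?i1 ?i2 ?L1 ?L2 ?fi ?fL.
have n1 : i%:R + j%:R + b%:R + 1 != 0 :> rat by rewrite -!natrD natr1 pnatr_eq0.
have n2 : i%:R + j%:R + b%:R + 1 + 1 != 0 :> rat by rewrite -!natrD !natr1 pnatr_eq0.
rewrite moment_recr !IH /moment_value.
rewrite !addnS !addSn !factrS ffactrS exprS -![_.+1%:R]natr1 !natrD.
have f1 := factr_neq0 (i + j + b); have f2 := factr_neq0 (L + e - b); have f3 := factr_neq0 L.
by field; rewrite n1 n2 f1 f2 f3.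
Qed.

End Moments.

(** * Determinants of ratios of factorials *)

Lemma factr_prod B n : factr (B + n) = factr B * \prod_(0 <= r < n) (B%:R + r%:R + 1).
Proof.
elim: n => [|n IH]; first by rewrite addn0 big_nil mulr1.
by rewrite addnS factrS IH big_nat_recr //= natrD; ring.
Qed.

Lemma det_scale (R : comNzRingType) n (r c : 'I_n -> R) (A : 'M[R]_n) :
  \det (\matrix_(i, j) (r i * c j * A i j)) = \prod_i r i * \prod_j c j * \det A.
Proof.
have -> : \matrix_(i, j) (r i * c j * A i j) =
    diag_mx (\row_i r i) *m A *m diag_mx (\row_j c j).
  by apply/matrixP=> i j; rewrite mul_diag_mx mul_mx_diag !mxE mulrAC.
rewrite !det_mulmx !det_diag mulrAC; congr (_ * _ * _);
  by apply: eq_bigr => i _; rewrite mxE.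
Qed.

Lemma det_column_step n (a : nat -> nat -> rat) (l : nat -> rat) :
  \det (\matrix_(i < n, j < n) a i j) =
  \det (\matrix_(i < n, j < n)
     (a i j + if (j : nat) is k.+1 then a i k * l k else 0)).
Proof.
pose U := \matrix_(k < n, j < n)
  ((k == j)%:R + (k.+1 == j)%:R * l k).
have -> : \matrix_(i < n, j < n)
     (a i j + if (j : nat) is k.+1 then a i k * l k else 0) =
   (\matrix_(i < n, j < n) a i j) *m U.
  apply/matrixP=> i j; rewrite !mxE.
  under [RHS]eq_bigr do rewrite !mxE mulrDr.
  rewrite big_split /=; congr (_ + _).
    rewrite (bigD1 j) //= eqxx mulr1 big1 ?addr0 // => k /negPf->.
    by rewrite mulr0.
  case: j => -[|j] jn /=; first by rewrite big1 // => k _; rewrite mul0r mulr0.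
  rewrite (bigD1 (Ordinal (ltnW jn))) //= eqxx mul1r big1 ?addr0 // => k.
  by rewrite -val_eqE /= eqSS => /negPf->; rewrite mul0r mulr0.
rewrite det_mulmx -[\det U]det_tr [\det U^T]det_trig; last first.
  apply/is_trig_mxP => i j ij; rewrite !mxE -val_eqE /=.
  by rewrite (gtn_eqF ij) (gtn_eqF (leqW ij)) mul0r addr0.
rewrite [X in _ * X]big1 ?mulr1 // => i _; rewrite !mxE eqxx (gtn_eqF (ltnSn i)).
by rewrite mul0r addr0.
Qed.

(* Each column is reduced by the multiple of the previous one that kills its entry
   in the first row; the minor left over is again of this shape, with
   (B, d) replaced by (B + 2, d - 1). *)
Lemma det_hankel_factr x B d : (x <= d.+1)%N ->
  \det (\matrix_(i < x, j < x)
     ((-1) ^+ j * (factr (B + d + i + j) / factr (B + i + j)))) =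
  \prod_(0 <= r < x) (factr (B + d + r) * factr r * (d ^_ r)%:R / factr (B + x.-1 + r)).
Proof.
elim: x B d => [|x IH] B d xd; first by rewrite det_mx00 big_nil.
(* The multiplier is minus the quotient of the first-row entries k + 1 and k, the signs (-1) ^+ j
   included. *)
rewrite (det_column_step _ (fun i j => (-1) ^+ j * (factr (B + d + i + j) / factr (B + i + j)))
  (fun k => (B + d + k.+1)%:R / (B + k.+1)%:R)).
rewrite (expand_det_row _ 0) big_ord_recl big1 ?addr0 => [|j _]; last first.
  rewrite !mxE /= !addn0 !addnS !factrS exprS -![_.+1%:R]natr1.
  have b1 : B%:R + j%:R + 1 != 0 :> rat by rewrite -natrD natr1 pnatr_eq0.
  have f1 := factr_neq0 (B + j).
  by rewrite [X in X * _](_ : _ = 0) ?mul0r //; field; rewrite b1 f1.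
rewrite !mxE /= addr0 !addn0 mul1r /cofactor mul1r.
case: x => [|x] in IH xd *.
  by rewrite det_mx00 mulr1 big_nat1 !addn0 ffactn0; congr (_ / _); rewrite /factr fact0 !mulr1.
case: d => [//|d] in xd *.
(* The reduced entry is a smaller matrix entry times i + 1 and [c j], which leave the determinant by
   [det_scale]. *)
pose c (j : 'I_x.+1) := d.+1%:R / (B%:R + j%:R + 1) : rat.
rewrite (_ : \det (row' _ _) = \det (\matrix_(i < x.+1, j < x.+1) (i.+1%:R * c j *
  (\matrix_(i < x.+1, j < x.+1) ((-1) ^+ j * (factr (B.+2 + d + i + j) / factr (B.+2 + i + j))))
     i j))); last first.
  congr (\det _); apply/matrixP=> i j; rewrite !mxE /= /bump /= !add1n /c.
  rewrite ?(addnS, addSn) !factrS exprS -![_.+1%:R]natr1 !natrD.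
  have b1 : B%:R + j%:R + 1 != 0 :> rat by rewrite -natrD natr1 pnatr_eq0.
  have b2 : B%:R + i%:R + j%:R + 1 != 0 :> rat by rewrite -!natrD natr1 pnatr_eq0.
  have b3 : B%:R + i%:R + j%:R + 1 + 1 != 0 :> rat by rewrite -!natrD !natr1 pnatr_eq0.
  have f1 := factr_neq0 (B + i + j).
  by field; rewrite b1 b2 b3 f1.
rewrite det_scale IH // [RHS]big_nat_recl //= /c !addn0.
rewrite -(big_mkord xpredT (fun i => i.+1%:R : rat)).
rewrite -(big_mkord xpredT (fun i => d.+1%:R / (B%:R + i%:R + 1) : rat)).
rewrite (factr_prod B x.+1) ffactn0 (_ : factr 0 = 1) // -!big_split /=.
rewrite [X in _ * X = _](eq_bigr (fun r => (B%:R + r%:R + 1)^-1 *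
  (factr (B + d.+1 + r.+1) * factr r.+1 * (d.+1 ^_ r.+1)%:R / factr (B + x.+1 + r.+1)))); last first.
  move=> r _; rewrite ?(addnS, addSn) !factrS ffactSS natrM -![_.+1%:R]natr1 !natrD.
  have f1 := factr_neq0 (B + x + r).
  have b1 : B%:R + r%:R + 1 != 0 :> rat by rewrite -natrD natr1 pnatr_eq0.
  have b2 : B%:R + x%:R + r%:R + 1 != 0 :> rat by rewrite -!natrD natr1 pnatr_eq0.
  have b3 : B%:R + x%:R + r%:R + 1 + 1 != 0 :> rat by rewrite -!natrD !natr1 pnatr_eq0.
  by field; rewrite b1 b2 b3 f1.
by rewrite big_split /= prodfV invfM !mulr1 !mulrA.
Qed.

(** * Blocks of factorials and MacMahon's product *)

Definition fact_block m x : rat := \prod_(0 <= r < x) factr (m + r).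

Lemma fact_block_neq0 m x : fact_block m x != 0.
Proof. by rewrite prodf_seq_neq0; apply/allP => r _; rewrite factr_neq0. Qed.

Lemma fact_blockD m x y : fact_block m (x + y) = fact_block m x * fact_block (m + x) y.
Proof.
rewrite /fact_block (big_cat_nat _ (leq_addr y x)) //=; congr (_ * _).
rewrite -[X in index_iota X]add0n big_addn addKn.
by apply: eq_bigr => r _; congr factr; lia.
Qed.

Lemma fact_block1 m : fact_block m 1 = factr m.
Proof. by rewrite /fact_block big_nat1 addn0. Qed.

Lemma fact_block_rev m x : (x <= m.+1)%N ->
  \prod_(0 <= r < x) factr (m - r) = fact_block (m.+1 - x) x.
Proof.
move=> xm; rewrite big_nat_rev; apply: eq_big_nat => r /andP[_ rx].
by congr factr; lia.
Qed.

Lemma ffactr n k : (k <= n)%N -> (n ^_ k)%:R = factr n / factr (n - k).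
Proof.
move=> kn; apply: (canRL (mulfK (factr_neq0 _))).
by rewrite /factr -natrM ffact_fact.
Qed.

(** Row and column factors leave the matrix of [det_hankel_factr] with B = b + 1 and d = L + e -
    b. *)
Lemma det_moment (e b : bool) L x : b ==> e -> (x <= L.+1)%N ->
  \det (\matrix_(i < x, j < x) moment e b L.+1 i j) =
  fact_block b x * fact_block 0 x ^+ 2 *
  fact_block (L.+1 + b) x * fact_block (L.+1 + e) x /
  (fact_block (L.+1 - x) x * fact_block ((L + e - b).+1 - x) x * fact_block (x + b) x).
Proof.
move=> be xL; pose d := (L + e - b)%N.
have bL : (L + e = b + d)%N by move: be; rewrite /d; case: (b); case: (e) => //= _; lia.
pose row (i : 'I_x) := factr (i + b) * (L ^_ i)%:R.
pose col (j : 'I_x) := factr j * factr (L + j + b).+1 / (factr d * factr L).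
have -> : \matrix_(i < x, j < x) moment e b L.+1 i j =
    \matrix_(i, j) (row i * col j * (\matrix_(i < x, j < x)
       ((-1) ^+ j * (factr (b.+1 + d + i + j) / factr (b.+1 + i + j)))) i j).
  apply/matrixP=> i j; rewrite !mxE momentE // /moment_value /row /col -/d.
  have -> : (b.+1 + d + i + j = (L + i + j + e).+1)%N by lia.
  have -> : (b.+1 + i + j = (i + j + b).+1)%N by lia.
  have [f1 [f2 f3]] := (factr_neq0 (i + j + b).+1, (factr_neq0 d, factr_neq0 L)).
  by field; rewrite f1 f2 f3.
have xd : (x <= d.+1)%N by move: bL be; case: (b); case: (e) => //= ? _; lia.
rewrite det_scale det_hankel_factr // /row /col.
rewrite -(big_mkord xpredT (fun i => factr (i + b) * (L ^_ i)%:R)).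
rewrite -(big_mkord xpredT (fun j => factr j * factr (L + j + b).+1 / (factr d * factr L))).
rewrite -(fact_block_rev xL) -(fact_block_rev xd) /fact_block -prodrXl.
rewrite -!big_split /= -prodf_div; apply: eq_big_nat => r /andP[_ rx].
rewrite !ffactr; [|lia|lia].
have -> : (b.+1 + d + r = L.+1 + e + r)%N by lia.
have -> : (b.+1 + x.-1 + r = x + b + r)%N by lia.
have -> : ((L + r + b).+1 = L.+1 + b + r)%N by lia.
rewrite add0n addnC.
have [f1 [f2 f3]] := (factr_neq0 d, (factr_neq0 L, factr_neq0 (L - r))).
have [f4 f5] := (factr_neq0 (d - r), factr_neq0 (x + b + r)).
by field; rewrite f1 f2 f3 f4 f5.
Qed.

(** The product over k telescopes to (i + j + c - 1) / (i + j - 1), and the product over j of these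
    is a ratio of factorials. *)
Lemma PP_fact_block a b c : PP a b c =
  fact_block 0 a * fact_block (b + c) a / (fact_block b a * fact_block c a).
Proof.
have n1 i j : i%:R + j%:R + 1 != 0 :> rat by rewrite -natrD natr1 pnatr_eq0.
have inner (i j : nat) : \prod_(1 <= k < c.+1)
    ((i.+1%:R + j.+1%:R + k%:R - 1) / (i.+1%:R + j.+1%:R + k%:R - 2)) =
    (i%:R + j%:R + c%:R + 1) / (i%:R + j%:R + 1) :> rat.
  rewrite big_add1 /=; elim: c => [|k IH]; first by rewrite big_nil addr0 divff.
  rewrite big_nat_recr //= IH -![_.+1%:R]natr1.
  have k1 : i%:R + j%:R + k%:R + 1 != 0 :> rat by rewrite -!natrD natr1 pnatr_eq0.
  have -> : i%:R + 1 + (j%:R + 1) + (k%:R + 1) - 2 = i%:R + j%:R + k%:R + 1 :> rat by ring.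
  by field; rewrite k1 n1.
have mid (i : nat) : \prod_(1 <= j < b.+1) \prod_(1 <= k < c.+1)
    ((i.+1%:R + j%:R + k%:R - 1) / (i.+1%:R + j%:R + k%:R - 2)) =
    factr i * factr (b + c + i) / (factr (b + i) * factr (c + i)).
  rewrite big_add1 /=; under eq_bigr do rewrite inner.
  have [f1 f2] := (factr_neq0 i, factr_neq0 (c + i)).
  elim: b => [|j IH]; first by rewrite big_nil add0n; field; rewrite f1 f2.
  rewrite big_nat_recr //= IH ?addSn !factrS !natrD.
  have f3 := factr_neq0 (j + i); have nij := n1 j i.
  by field; rewrite f2 f3 nij.
rewrite /PP big_add1 /= /fact_block -!big_split /= -prodf_div.
by apply: eq_bigr => i _; rewrite mid add0n.
Qed.

(** * From tilings to moments, and the three cases *)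

Definition ffact_poly k : {poly rat} := \prod_(0 <= l < k) ('X - l%:R%:P).

Lemma horner_ffact_poly k n : (ffact_poly k).[n%:R] = (n ^_ k)%:R.
Proof.
elim: k => [|k IH]; first by rewrite /ffact_poly big_nil hornerC.
by rewrite /ffact_poly big_nat_recr //= hornerM hornerXsubC IH ffactrS.
Qed.

(** r! 'C(v, r) is a falling factorial, a monic polynomial of degree r in v, so scaling the columns
    reduces this to [det_monic_vdm]. *)
Lemma rowdet_vdm k u : rowdet k (map binrow u) * fact_block 0 k =
  if size u == k then vdm [seq v%:R | v <- u] else 0.
Proof.
rewrite /rowdet size_map; case: eqP => [uk|_]; last by rewrite mul0r.
have sz : size [seq v%:R : rat | v <- u] = k by rewrite size_map.
rewrite -(det_monic_vdm (P := ffact_poly) sz); first last.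
- by move=> r; rewrite /ffact_poly size_prod_XsubC size_iota subn0.
- by move=> r; apply: monic_prod => l _; exact: monicXsubC.
have -> : fact_block 0 k = \prod_(i < k) 1 * \prod_(i < k) factr i.
  by rewrite /fact_block big_mkord [X in _ = X * _]big1 ?mul1r.
rewrite mulrC -det_scale; congr (\det _).
apply/matrixP=> j r; rewrite !mxE mul1r !(nth_map 0%N) ?uk //.
by rewrite horner_ffact_poly /binrow /factr -natrM mulnC bin_ffact.
Qed.

Lemma SC_moment x m M (e b : bool) : b ==> e -> (0 < 2 * x + b)%N ->
  (2 * x + b + m = M + e + M)%N ->
  (SC (2 * x + b) (2 * x + b) m)%:R * fact_block 0 (2 * x + b) =
  \det (\matrix_(i < x, j < x) moment e b M i j).
Proof.
set n := (2 * x + b)%N => be n0 nm.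
rewrite SC_tilings // natr_sum big_distrl /=.
transitivity (\sum_(S : {set 'I_(n + m)} | symmetric_set S && (#|S| == n))
   vdm [seq v%:R : rat | v <- vals S]).
  rewrite [RHS]big_mkcondr; apply: eq_bigr => S _.
  rewrite /low tilings_trapezoid //; first last.
  - by move=> v; exact: vals_lt.
  - exact: sorted_vals.
  - by move: n0; lia.
  by rewrite addnK rowdet_vdm size_map -cardE.
rewrite (sum_symmetric nm x (fun s => vdm [seq v%:R : rat | v <- s]) be).
rewrite -(sum_vdm_sqr _ _ _ (monic_node_poly e 0) (size_node_poly e 0)
  (monic_node_poly e M) (size_node_poly e M)).
apply: eq_bigr => T _; rewrite vdm_symseq //; last by move=> v; exact: vals_lt.
by rewrite big_map -map_comp.
Qed.

Theorem theorem7p1 (x y : nat) (hx : (0 < x)%N) (hy : (0 < y)%N) :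
  [/\ ((SC (2 * x) (2 * x) (2 * y))%:R = PP x x y ^+ 2 :> rat)%R,
      ((SC (2 * x) (2 * x) (2 * y + 1))%:R =
         PP x x y * PP x x (y + 1) :> rat)%R
    & ((SC (2 * x + 1) (2 * x + 1) (2 * y))%:R =
         PP x (x + 1) y ^+ 2 :> rat)%R].
Proof.
have eL : (x + y = (x + y).-1.+1)%N by lia.
have xL : (x <= (x + y).-1.+1)%N by lia.
have fb := fact_block_neq0.
have Z : nat_of_bool false = 0%N by [].
have E1 : nat_of_bool true = 1%N by [].
have block2x : fact_block 0 (2 * x) = fact_block 0 x * fact_block x x.
  by rewrite mul2n -addnn fact_blockD.
split; rewrite !PP_fact_block.
(* N = 2(x + y): the centre is a half-integer and the dents come in pairs. *)
- have := @SC_moment x (2 * y) (x + y) false false isT ltac:(lia) ltac:(lia).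
  have := @det_moment false false _ x isT xL; rewrite -eL => ->.
  rewrite Z !addn0 subn0 -eL addKn block2x => h.
  apply: (mulIf (mulf_neq0 (fb 0%N x) (fb x x))); rewrite h.
  by field; rewrite !fb.
(* N is odd and n even, so the centre is a position but not a dent. *)
- have := @SC_moment x (2 * y + 1) (x + y) true false isT ltac:(lia) ltac:(lia).
  have := @det_moment true false _ x isT xL; rewrite -eL => ->.
  have L1 : ((x + y).-1 + 1 - 0 = x + y)%N by lia.
  rewrite Z E1 !addn0 L1 -addnS !addKn block2x -addnA => h.
  apply: (mulIf (mulf_neq0 (fb 0%N x) (fb x x))); rewrite h (addn1 y).
  by field; rewrite !fb.
(* N and n are odd, so the centre is a dent. *)
- have := @SC_moment x (2 * y) (x + y) true true isT ltac:(lia) ltac:(lia).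
  have := @det_moment true true _ x isT xL; rewrite -eL => ->.
  rewrite E1 addnK -eL addKn => h.
  (* The leading factor 0! = 1 is split off, leaving two blocks of length x. *)
  have b1 : fact_block 0 (2 * x + 1) = fact_block 1 x * fact_block (x + 1) x.
    rewrite (_ : 2 * x + 1 = 1 + x + x)%N; last by lia.
    by rewrite !fact_blockD fact_block1 (_ : factr 0 = 1) // mul1r !add0n addnC.
  apply: (mulIf (fb 0%N (2 * x + 1)%N)); rewrite h b1 addnAC.
  by field; rewrite !fb.
Qed.
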